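(* The local surface tension $\mathrm{ent}(s)$ is convex in every coordinate. In particular, this implies that $\mathrm{ent}(s)$ is convex.
   Context: $m\ge2$. In $\mathbb{Z}^m$, $x\sim y$ means $|x-y|_{\ell_1}=1$; $\vec i_1,\dots,\vec i_m$ are the standard basis vectors. The $d$-regular rooted tree $\mathcal T$, with graph distance $d_{\mathcal T}$, is identified with the Cayley graph of $G=\langle\alpha_1,\dots,\alpha_d\mid\alpha_1^2=\dots=\alpha_d^2=e\rangle$ generated by the $\alpha_i$, the root $\mathbf r$ being the identity, so that neighbouring vertices $w,w'$ satisfy $w'=\alpha_iw$ for a unique $i$. A map $h:\mathbb{Z}^m\to\mathcal T$ is a graph homomorphism if $d_{\mathcal T}(h(x),h(y))=1$ whenever $x\sim y$; its dual map is $\tilde h(e_{xy})=\alpha_i$, where $x\sim y$ and $\alpha_i$ is the unique generator with $h(y)=\alpha_ih(x)$ ($e_{xy}$ is the oriented edge from $x$ to $y$). $h$ is $n$-translation invariant if $\tilde h(e_{xy})=\tilde h(e_{(x+n\vec i_k)(y+n\vec i_k)})$ for all $x\sim y$ and $k\in\{1,\dots,m\}$. The slope of such an $h$ is $(s_1,\dots,s_m)$ with $s_k=\frac1n\min_{x\in\mathbb{Z}^m}d_{\mathcal T}(h(x),h(x+n\vec i_k))$. A two-sided geodesic is a one-to-one graph homomorphism $\mathbf g:\mathbb{Z}\to\mathcal T$; $\Pi_{\mathbf g}:\mathcal T\to\mathbf g$ is the projection onto it. An $n$-translation invariant $h$ is supported on $\mathbf g$ if $d_{\mathcal T}(h(x),\mathbf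 g)\le\frac{mn}2$ for all $x\in\mathbb{Z}^m$ (if the slope is nonzero there is exactly one such two-sided geodesic). Let $\mathbf g$ be a periodic two-sided geodesic (its sequence of edge colours $\alpha_i$ is periodic), parametrized with $\mathbf g(0)=\mathbf r$. For $s\in[-1,1]^m$ with $|s|_{\ell_1}<1$, $\mathcal H^{\mathbf g}_n(s)$ is the set of $n$-translation invariant graph homomorphisms $h:\mathbb{Z}^m\to\mathcal T$ with slope $\big(\frac{\lfloor s_1n\rfloor}n,\dots,\frac{\lfloor s_mn\rfloor}n\big)$, supported on $\mathbf g$, such that $\Pi_{\mathbf g}(h(0))=\mathbf g(0)$ if $d_{\mathcal T}(h(0),\Pi_{\mathbf g}(h(0)))$ is even and $\Pi_{\mathbf g}(h(0))=\mathbf g(1)$ otherwise. The microscopic surface tension is $\mathrm{ent}_n(s)=-\frac1{n^m}\ln|\mathcal H^{\mathbf g}_n(s)|$; it does not depend on the choice of $\mathbf g$. The local surface tension is $\mathrm{ent}(s)=\lim_{n\to\infty}\mathrm{ent}_n(s)$ for $|s|_{\ell_1}<1$ (the limit exists), and $\mathrm{ent}(s)=0$ for $|s|_{\ell_1}=1$.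
   Formalization: The slope prescribed is |q⌊s_k n/q⌋|/n, with q the least even colour period of g, and ent is the limit over even n: with ⌊s_k n⌋/n the set is empty for infinitely many n (n times the slope has the parity of n) and for all negative s_k. *)

(* Defs.v *)
From HB Require Import structures.
From mathcomp Require Import all_boot all_order all_algebra finmap.
From mathcomp Require Import all_classical all_reals all_analysis.

Set Implicit Arguments.
Unset Strict Implicit.
Unset Printing Implicit Defensive.

Import Order.TTheory GRing.Theory Num.Theory.
Import numFieldNormedType.Exports.
Local Open Scope ring_scope.
Local Open Scope classical_set_scope.

(* Only used on nonempty sets, where it is the true minimum. *)
Definition natmin (A : set nat) : nat :=
  xget 0%N [set j | A j /\ forall i, A i -> (j <= i)%N].

(* An element of <alpha_1, .., alpha_d | alpha_i^2 = e> is represented by its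
   unique reduced word, i.e. a word without two equal consecutive letters. *)
Definition reduced (d : nat) (w : seq 'I_d) : bool :=
  sorted (fun a b => a != b) w.

Definition tree (d : nat) : Type := {w : seq 'I_d | reduced w}.

Definition tree_root (d : nat) : tree d := exist _ [::] isT.

Definition cons_red (d : nat) (i : 'I_d) (w : seq 'I_d) : seq 'I_d :=
  if w is j :: w' then if i == j then w' else i :: w else [:: i].

Lemma cons_red_reduced (d : nat) (i : 'I_d) (w : seq 'I_d) :
  reduced w -> reduced (cons_red i w).
Proof.
case: w => [//|j w] /=; case: eqVneq => [_|nij] hw; first exact: path_sorted hw.
by rewrite /reduced /= nij.
Qed.

(* The left multiplication w |-> alpha_i w. *)
Definition tree_act (d : nat) (i : 'I_d) (w : tree d) : tree d :=
  exist _ (cons_red i (sval w)) (cons_red_reduced i (svalP w)).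

(* Graph distance in the Cayley graph: the least number of edges of a walk from
   w to w', a walk being given by the sequence of generators it uses. *)
Definition tree_dist (d : nat) (w w' : tree d) : nat :=
  natmin [set k | exists2 p : seq 'I_d,
                    size p = k & foldr (@tree_act d) w p = w'].

(* The unique alpha_i with w' = alpha_i w; None if w, w' are not neighbours. *)
Definition colour (d : nat) (w w' : tree d) : option 'I_d :=
  [pick i | w' == tree_act i w].

Definition two_sided_geodesic (d : nat) (g : int -> tree d) : Prop :=
  injective g /\ forall i j : int, `|i - j| = 1 -> tree_dist (g i) (g j) = 1%N.

Definition colour_period (d : nat) (g : int -> tree d) (q : nat) : Prop :=
  (0 < q)%N /\
  forall i : int,
    colour (g (i + q%:Z)) (g (i + q%:Z + 1)) = colour (g i) (g (i + 1)).

Definition periodic_geodesic (d : nat) (g : int -> tree d) : Prop :=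
  exists q, colour_period g q.

Definition even_period (d : nat) (g : int -> tree d) : nat :=
  natmin [set q | colour_period g q /\ ~~ odd q].

(* The projection on g is the point of g nearest to w. *)
Definition geod_proj (d : nat) (g : int -> tree d) (w : tree d) : tree d :=
  g (xget 0 [set i | forall j, (tree_dist w (g i) <= tree_dist w (g j))%N]).

Definition l1norm (R : numDomainType) (m : nat) (x : 'rV[R]_m) : R :=
  \sum_(k < m) `|x 0 k|.

Definition zadj (m : nat) (x y : 'rV[int]_m) : Prop := l1norm (x - y) = 1.

Definition zbasis (m : nat) (k : 'I_m) : 'rV[int]_m := delta_mx 0 k.

Definition graph_hom (m d : nat) (h : 'rV[int]_m -> tree d) : Prop :=
  forall x y, zadj x y -> tree_dist (h x) (h y) = 1%N.

Definition dual_map (m d : nat) (h : 'rV[int]_m -> tree d) (x y : 'rV[int]_m) :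
  option 'I_d := colour (h x) (h y).

Definition translation_invariant (m d n : nat) (h : 'rV[int]_m -> tree d) :
    Prop :=
  forall x y k, zadj x y ->
    dual_map h x y = dual_map h (x + zbasis k *+ n) (y + zbasis k *+ n).

Definition slope (R : realType) (m d n : nat) (h : 'rV[int]_m -> tree d)
    (k : 'I_m) : R :=
  (natmin (range (fun x => tree_dist (h x) (h (x + zbasis k *+ n)))))%:R / n%:R.

Definition supported (m d n : nat) (g : int -> tree d)
    (h : 'rV[int]_m -> tree d) : Prop :=
  forall x, (2 * tree_dist (h x) (geod_proj g (h x)) <= m * n)%N.

(* An n-translation invariant h satisfies h (x + n i_k) = h x * gamma_k, where
   gamma_k has the parity of n and, as soon as the slope is nonzero, preserves
   the coloured geodesic g on which h is supported.  So n times the slope is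
   congruent to n modulo 2 and divisible by the colour period of g: prescribing
   the slope floor (s_k n) / n would give an empty set for most n, and -ln of
   its cardinality would have no limit.  Hence s_k n is rounded down to a
   multiple of the least even period q of g, and only even n are used in [ent].
   When n is even and q divides floor (s_k n), this is exactly floor (s_k n). *)
Definition target (R : realType) (m d n : nat) (g : int -> tree d)
    (s : 'rV[R]_m) (k : 'I_m) : int :=
  let q := even_period g in
  q%:Z * Num.floor (s 0 k * n%:R / q%:R).

(* The slope, being made of distances, is nonnegative, whereas s ranges over
   [-1, 1]^m: hence the absolute value of the target. *)
Definition Hset (R : realType) (m d n : nat) (g : int -> tree d)
    (s : 'rV[R]_m) : set ('rV[int]_m -> tree d) :=
  [set h | [/\ graph_hom h,
               translation_invariant n h,
               forall k, slope R n h k = `|target n g s k|%:~R / n%:R,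
               supported n g h
             & geod_proj g (h 0) =
               if odd (tree_dist (h 0) (geod_proj g (h 0))) then g 1 else g 0]].

(* Hset is finite for n > 0, so that #|` fset_set _ | is its cardinality. *)
Definition ent_n (R : realType) (m d n : nat) (g : int -> tree d)
    (s : 'rV[R]_m) : R :=
  - (ln (#|` fset_set (Hset n g s)|%:R) / n%:R ^+ m).

Definition ent_seq (R : realType) (m d : nat) (g : int -> tree d)
    (s : 'rV[R]_m) : R^nat :=
  fun j => ent_n j.*2 g s.

Definition ent (R : realType) (m d : nat) (g : int -> tree d)
    (s : 'rV[R]_m) : R :=
  if l1norm s < 1 then lim (ent_seq g s @ \oo) else 0.

Definition set_coord (R : realType) (m : nat) (s : 'rV[R]_m) (k : 'I_m)
    (t : R) : 'rV[R]_m :=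
  \row_j (if j == k then t else s 0 j).

(* Convexity on {s : |s|_1 <= 1}, where the surface tension is defined. *)
Definition coordinatewise_convex (R : realType) (m : nat)
    (f : 'rV[R]_m -> R) : Prop :=
  forall (s : 'rV[R]_m) (k : 'I_m),
    convex_function [set t : R^o | l1norm (set_coord s k t) <= 1]
      (fun t => f (set_coord s k t)).

Definition convex_on_ball (R : realType) (m : nat) (f : 'rV[R]_m -> R) :
    Prop :=
  convex_function [set s : 'rV[R]_m | l1norm s <= 1] f.

(* Main.v *)
(* Convexity inside the ball follows from the midpoint inequality, because [ent]
   is bounded above by 0; the boundary value 0 is then harmless. For the midpoint
   s of s1 and s2, take a large cell on which the affine profile of slope s is
   replaced by a laminate: a zigzag with slopes s1 and s2, of amplitude small
   compared with the cell. Cut the cell into cubes of side n and fill each cube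
   away from the kinks and from the boundary by a sample of slope s1 or s2.
   Samples are taken in a class of configurations agreeing on the faces of the
   cubes, which costs only exp(O(n^(m-1))) by pigeonhole, so they fit together
   within a strip; the gaps between strips and between cells are filled by a
   McShane extension for tree-valued maps, the slopes being strictly less than 1.
   Exchanging the roles of s1 and s2 gives two families of configurations of
   slope s in which every cube is filled once with each slope, hence
   Z_N(s)^2 >= (Z_n(s1) Z_n(s2))^(number of cubes) up to lower order. *)
Require Import Defs.
From mathcomp Require Import all_boot all_order all_algebra finmap.
From mathcomp Require Import all_classical all_reals all_analysis.
From mathcomp Require Import zify ring lra.

Set Implicit Arguments.
Unset Strict Implicit.
Unset Printing Implicit Defensive.

Import Order.TTheory GRing.Theory Num.Theory.
Import numFieldNormedType.Exports.
Local Open Scope ring_scope.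
Local Open Scope classical_set_scope.

(** A supremum of tree-valued data needs an order. Orienting every edge towards the end g(-oo) of
    the geodesic gives each vertex one parent and an integer height; two ancestors of compatible
    data at the same high enough level then coincide, so McShane's formula has a well-defined value.
    The formula is canonical, hence periodic data extend periodically. The second obstacle is that
    [Hset] prescribes the slope only up to sign and does not say that the period maps translate [g].
    The set of least displacement of a period map settles this: it spreads over [g], except when the
    displacement is 1 (inversion of an edge), which evenness of the target excludes. Reflecting
    coordinates then fixes the signs. The slack comes from |s|_1 < 1: with a margin 2/p, half
    absorbs the rounding of the targets and half becomes [e], of order n/p. Only a proportion 1/J of
    the cubes is lost near kinks, because the phase of the zigzag is chosen as the best of J
    translates. The limits are taken in the order: size of the cell, then n, then J. Joint convexity
    is what is proved; convexity in each coordinate is its restriction to lines. *)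

Lemma natminP (A : set nat) n : A n -> A (natmin A) /\ forall i, A i -> (natmin A <= i)%N.
Proof.
move=> An; have [k kP] : exists k, A k /\ forall i, A i -> (k <= i)%N.
  have ex : exists k, `[< A k >] by exists n; apply/asboolP.
  exists (ex_minn ex); case: ex_minnP => k /asboolP Ak kP; split=> // i Ai.
  by apply: kP; apply/asboolP.
by rewrite /natmin; case: xgetP => [j -> //|/(_ k)].
Qed.

Lemma natmin_mem (A : set nat) n : A n -> A (natmin A).
Proof. by case/natminP. Qed.

Lemma natmin_le (A : set nat) n : A n -> (natmin A <= n)%N.
Proof. by move=> An; apply: (natminP An).2. Qed.

(** * The tree *)

Section Tree.
Variable d : nat.
Implicit Types (w v u : tree d) (p : seq 'I_d) (i : 'I_d).

Local Notation act := (@tree_act d).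
Local Notation root := (tree_root d).
Definition walk w p : tree d := foldr act w p.

Lemma tree_inj w w' : sval w = sval w' -> w = w'.
Proof. exact: val_inj. Qed.

Lemma tree_actK i : involutive (act i).
Proof.
move=> [w rw]; apply: tree_inj => /=; case: w rw => [|j w] //=; first by rewrite eqxx.
case: eqVneq => [<-|ij] rw; last by rewrite /= eqxx.
by case: w rw => [|k w] //= /andP[/negbTE ->].
Qed.

Lemma tree_act_inj i j w : act i w = act j w -> i = j.
Proof.
have size_neq (s s' : seq 'I_d) : size s <> size s' -> s <> s' by move=> + e; rewrite e.
case: w => [w rw] /(congr1 sval) /=; case: w rw => [_ [//]|k w rw] /=.
case: (eqVneq i k) => [->|_]; case: (eqVneq j k) => [->|_] //.
- by move/(congr1 size)=> /=; lia.
- by move/(congr1 size)=> /=; lia.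
by case.
Qed.

Lemma walk_cat w p p' : walk w (p ++ p') = walk (walk w p') p.
Proof. exact: foldr_cat. Qed.

Lemma walk_rev w p : walk (walk w p) (rev p) = w.
Proof.
elim: p => [//|i p IH] /=.
by rewrite rev_cons -cats1 walk_cat /= tree_actK IH.
Qed.

Lemma walk_root w : walk root (sval w) = w.
Proof.
apply: tree_inj; case: w => w rw /=; elim: w rw => [//|i w IH] rw.
rewrite /= IH; last exact: path_sorted rw.
by case: w rw {IH} => [|j w] //= /andP[/negbTE ->].
Qed.

Lemma walk_connected w w' : exists p, walk w p = w'.
Proof.
exists (sval w' ++ rev (sval w)); rewrite walk_cat.
by rewrite -{1}(walk_root w) walk_rev walk_root.
Qed.

Lemma size_walk_root p : (size (sval (walk root p)) <= size p)%N.
Proof.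
elim: p => [//|i p IH] /=; move: (sval _) IH => s; case: s => [|j s] //=.
by case: ifP => _ /=; lia.
Qed.

(** These are the right multiplications of the group, that is, the automorphisms of the tree
    preserving edge colours. One value determines such a map, and any value can be prescribed at one
    vertex. *)
Definition equivariant (f : tree d -> tree d) := forall i w, f (act i w) = act i (f w).

Lemma equivariant_walk f : equivariant f -> forall w p, f (walk w p) = walk (f w) p.
Proof. by move=> ef w; elim=> [//|i p IH] /=; rewrite ef IH. Qed.

Lemma equivariant_eq f f' w :
  equivariant f -> equivariant f' -> f w = f' w -> f =1 f'.
Proof.
move=> ef ef' e v; have [p <-] := walk_connected w v.
by rewrite !equivariant_walk // e.
Qed.

(* Right multiplication by [u] in the group of reduced words. *)
Definition rmul u w : tree d := walk u (sval w).

Lemma rmul_equivariant u : equivariant (rmul u).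
Proof.
move=> i [w rw]; rewrite /rmul /=; case: w rw => [//|j w] /= rw.
by case: eqVneq => [->|//]; rewrite tree_actK.
Qed.

Lemma rmul_root u : rmul u root = u. Proof. by []. Qed.

Lemma equivariant_comp f f' : equivariant f -> equivariant f' -> equivariant (f \o f').
Proof. by move=> ef ef' i w /=; rewrite ef' ef. Qed.

Lemma equivariant_ex w w' : exists2 f, equivariant f & f w = w'.
Proof.
(* The reversed word of [w] represents its inverse, so the inner factor sends [w] to the root and
   the outer one sends the root to [w']. *)
exists (rmul w' \o rmul (walk root (rev (sval w)))).
  by apply: equivariant_comp; apply: rmul_equivariant.
by rewrite /= [X in rmul _ X](_ : _ = root) // /rmul -{2}[sval w]revK walk_rev.
Qed.

Lemma equivariant_inv f : equivariant f ->
  exists f', [/\ equivariant f', cancel f f' & cancel f' f].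
Proof.
move=> ef; have [f' ef' f'r] := equivariant_ex (f root) root; exists f'; split=> //.
- apply: (@equivariant_eq (f' \o f) id root) => //; exact: equivariant_comp.
- apply: (@equivariant_eq (f \o f') id (f root)) => //=; last by rewrite f'r.
  exact: equivariant_comp.
Qed.

Lemma equivariant_inj f : equivariant f -> injective f.
Proof. by move=> /equivariant_inv[f' [_ fK _]]; exact: can_inj fK. Qed.

Lemma tree_dist_walk w w' : exists2 p, size p = tree_dist w w' & walk w p = w'.
Proof.
have [p pe] := walk_connected w w'.
by apply: (@natmin_mem [set k | exists2 p, size p = k & walk w p = w'] (size p)); exists p.
Qed.

Lemma tree_dist_le w p : (tree_dist w (walk w p) <= size p)%N.
Proof. by apply: natmin_le; exists p. Qed.

Lemma tree_dist_equivariant f w w' : equivariant f ->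
  tree_dist (f w) (f w') = tree_dist w w'.
Proof.
move=> ef; apply/eqP; rewrite eqn_leq; apply/andP; split.
- have [p <- <-] := tree_dist_walk w w'.
  by rewrite equivariant_walk // tree_dist_le.
- have [p <-] := tree_dist_walk (f w) (f w').
  rewrite -equivariant_walk // => /(equivariant_inj ef) <-; exact: tree_dist_le.
Qed.

Lemma tree_dist_root w : tree_dist root w = size (sval w).
Proof.
apply/eqP; rewrite eqn_leq; apply/andP; split.
- by rewrite -{1}(walk_root w) tree_dist_le.
- have [p <- e] := tree_dist_walk root w; rewrite -{1}e; exact: size_walk_root.
Qed.

Lemma tree_dist0 w w' : tree_dist w w' = 0%N -> w = w'.
Proof. by move=> e; have [p] := tree_dist_walk w w'; rewrite e => /size0nil -> <-. Qed.

Lemma tree_distxx w : tree_dist w w = 0%N.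
Proof. by have := tree_dist_le w [::]; rewrite leqn0 => /eqP. Qed.

Lemma tree_distC w w' : tree_dist w w' = tree_dist w' w.
Proof.
suff H v v' : (tree_dist v v' <= tree_dist v' v)%N by apply/eqP; rewrite eqn_leq !H.
have [p <- <-] := tree_dist_walk v' v.
by rewrite -{2}(walk_rev v' p) -(size_rev p) tree_dist_le.
Qed.

Lemma tree_dist_trans v w w' : (tree_dist w w' <= tree_dist w v + tree_dist v w')%N.
Proof.
have [p <- <-] := tree_dist_walk w v; have [p' <- <-] := tree_dist_walk (walk w p) w'.
by rewrite -walk_cat addnC -size_cat tree_dist_le.
Qed.

Definition adj w w' := exists i, w' = act i w.

Lemma tree_act_neq i w : act i w <> w.
Proof.
move/(congr1 (fun v => size (sval v))); case: w => [[|j w] rw] //=.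
by case: ifP => _ /=; lia.
Qed.

Lemma adj_neq w w' : adj w w' -> w <> w'.
Proof. by move=> [i ->] e; apply: (@tree_act_neq i w). Qed.

Lemma adj_dist w w' : adj w w' <-> tree_dist w w' = 1%N.
Proof.
split=> [aw|].
- have [i e] := aw; have : (tree_dist w w' <= 1)%N by rewrite e (tree_dist_le w [:: i]).
  case E : (tree_dist w w') => [|[|]] // _; case: (adj_neq aw); exact: tree_dist0.
- move=> e; have [p] := tree_dist_walk w w'; rewrite e.
  by case: p => [|i [|]] // _ <-; exists i.
Qed.

Lemma adjC w w' : adj w w' -> adj w' w.
Proof. by move=> [i ->]; exists i; rewrite tree_actK. Qed.

Lemma adj_equivariant f w w' : equivariant f -> adj (f w) (f w') <-> adj w w'.
Proof. by move=> ef; rewrite !adj_dist tree_dist_equivariant. Qed.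

Lemma colour_act i w : colour w (act i w) = Some i.
Proof.
rewrite /colour; case: pickP => [j /eqP /tree_act_inj ->//|/(_ i)].
by rewrite eqxx.
Qed.

Lemma colourP w w' i : colour w w' = Some i -> w' = act i w.
Proof. by rewrite /colour; case: pickP => // j /eqP -> [->]. Qed.

Lemma colour_adj w w' : adj w w' -> exists2 i, colour w w' = Some i & w' = act i w.
Proof. by move=> [i ->]; exists i => //; rewrite colour_act. Qed.

Lemma colour_equivariant f w w' : equivariant f -> colour (f w) (f w') = colour w w'.
Proof.
move=> ef; rewrite /colour; apply: eq_pick => i.
by rewrite -ef; apply/eqP/eqP => [/(equivariant_inj ef)|->].
Qed.

End Tree.

(** * The tree seen from an end of the geodesic *)

Section Ray.
Variables (d : nat) (r : nat -> tree d).
Hypothesis r_inj : injective r.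
Hypothesis r_adj : forall j, adj (r j) (r j.+1).
Hypothesis r0 : r 0%N = tree_root d.

(** A step that cancels a letter would return to the previous vertex, which injectivity forbids. *)
Lemma ray_cons j : exists a, sval (r j.+1) = a :: sval (r j).
Proof.
elim: j => [|j [a IH]].
  by have [a ->] := r_adj 0; exists a; rewrite r0.
have [b e] := r_adj j.+1; exists b; rewrite e /= IH /=.
case: eqVneq => // ba; have /r_inj : r j.+2 = r j by apply: tree_inj; rewrite e /= IH /= ba eqxx.
lia.
Qed.

Lemma ray_size j : size (sval (r j)) = j.
Proof. by elim: j => [|j IH]; [rewrite r0|have [a ->] := ray_cons j; rewrite /= IH]. Qed.

End Ray.

Section End.
Variables (d : nat) (g : int -> tree d).
Hypothesis g_geodesic : two_sided_geodesic g.
Hypothesis g0 : g 0 = tree_root d.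
Implicit Types (w v : tree d) (i z : int).

Let g_inj : injective g. Proof. by case: g_geodesic. Qed.

Lemma geodesic_adj i : adj (g i) (g (i + 1)).
Proof. by apply/adj_dist; apply: g_geodesic.2; lia. Qed.

Lemma geodesic_cons (sg : int) (j : nat) : sg = 1 \/ sg = -1 ->
  size (sval (g (sg * j%:Z))) = j /\
  exists a, sval (g (sg * j.+1%:Z)) = a :: sval (g (sg * j%:Z)).
Proof.
move=> sgP; pose r (k : nat) := g (sg * k%:Z).
have r_inj : injective r by move=> a b /g_inj; case: sgP => ->; lia.
have r_adj k : adj (r k) (r k.+1).
  rewrite /r; case: sgP => ->; last first.
    by apply: adjC; have := geodesic_adj (-1 * k.+1%:Z); congr (adj _ (g _)); lia.
  by have := geodesic_adj (k%:Z); congr (adj (g _) (g _)); lia.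
have r0 : r 0%N = tree_root d by rewrite /r mulr0.
split; [exact: (ray_size r_inj r_adj r0 j) | exact: (ray_cons r_inj r_adj r0 j)].
Qed.

(* The neighbour of [w] towards the end [g(-oo)] of the tree. *)
Definition up w : tree d :=
  if w == g (- (size (sval w))%:Z) then g (- (size (sval w))%:Z - 1)
  else if sval w is i :: _ then tree_act i w else w.

(** Off the negative half of [g], the path to the end g(-oo) starts towards the root, that is, by
    deleting the first letter. On that half it leads away from the root, and then [v] is the
    preceding point of the same half-line. *)
Lemma up_cons w v a : sval w = a :: sval v -> up w = v \/ up v = w.
Proof.
move=> wv; rewrite /up; case: eqP => [wg|wg]; last first.
  by left; rewrite wv; apply: tree_inj; rewrite /= wv /= eqxx.
right; suff vg : v = g (- (size (sval v))%:Z).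
  by rewrite -vg eqxx [RHS]wg wv /=; congr g; lia.
have [b e] := (geodesic_cons (size (sval v)) (or_intror (erefl (-1 : int)))).2.
apply: tree_inj; have := e; rewrite !mulN1r.
by move: (congr1 sval wg); rewrite wv /= => <- [].
Qed.

Lemma up_g i : up (g i) = g (i - 1).
Proof.
rewrite /up; case: eqP => [e|ne].
  by rewrite {2}(g_inj e).
have [j ij] : exists j : nat, i = j.+1%:Z.
  have [?|?] := leP i 0; last by exists `|i|.-1%N; lia.
  exfalso; apply: ne; congr g; have [e _] := geodesic_cons `|i|%N (or_intror (erefl (-1 : int))).
  have -> : i = -1 * `|i|%N%:Z by lia.
  by rewrite e; lia.
have [e [a ea]] := geodesic_cons j (or_introl (erefl (1 : int))); move: ea; rewrite !mul1r -ij => ea.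
rewrite ea; apply: tree_inj; rewrite /= ea /= eqxx; congr (sval (g _)); lia.
Qed.

Lemma adj_up w : adj w (up w).
Proof.
rewrite /up; case: eqP => [{1}->|ne].
  by apply: adjC; have := geodesic_adj (- (size (sval w))%:Z - 1); rewrite subrK.
case e : (sval w) => [|i s]; last by exists i.
by case: ne; rewrite e g0; apply: tree_inj.
Qed.

Lemma adj_upP w w' : adj w w' <-> w' = up w \/ w = up w'.
Proof.
split=> [[i ->]|[->|->]]; [|exact: adj_up|exact/adjC/adj_up].
case e : (sval w) => [|j s].
  have /up_cons[->|->] : sval (tree_act i w) = i :: sval w by rewrite /= e.
    by right.
  by left.
have [ij|ij] := eqVneq i j.
  have /up_cons[->|->] : sval w = j :: sval (tree_act i w) by rewrite /= e /= ij eqxx.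
    by left.
  by right.
have /up_cons[->|->] : sval (tree_act i w) = i :: sval w by rewrite /= e /= (negbTE ij).
  by right.
by left.
Qed.

Lemma iter_up_g k i : iter k up (g i) = g (i - k%:Z).
Proof. by elim: k => [|k /= ->]; rewrite ?subr0 // up_g; congr g; lia. Qed.

Lemma up_reach w : exists k i, iter k up w = g i.
Proof.
have [n] := ubnP (size (sval w)); elim: n w => // n IH w wn.
case e : (sval w) => [|a s].
  by exists 0%N, 0; rewrite g0; apply: tree_inj.
have se : sval (tree_act a w) = s by rewrite /= e /= eqxx.
have [k [i ki]] : exists k i, iter k up (tree_act a w) = g i.
  by apply: IH; rewrite se; move: wn; rewrite e.
have /up_cons[u|u] : sval w = a :: sval (tree_act a w) by rewrite se.
  by exists k.+1, i; rewrite iterSr u.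
case: k ki => [|k] /= ki.
  by exists 0%N, (i - 1); rewrite /= -u ki up_g.
by exists k, i; move: ki; rewrite -iterS iterSr u.
Qed.

(* The Busemann function of the end [g(-oo)], normalized by [ht (g i) = i]. *)
Definition ht w : int :=
  xget 0 [set z | exists k : nat, iter k up w = g (z - k%:Z)].

Lemma ht_uniq w z k : iter k up w = g (z - k%:Z) -> ht w = z.
Proof.
move=> e; rewrite /ht; case: xgetP => [y _ [k' e']|/(_ z)]; last by case; exists k.
have : iter (k + k') up w = iter (k' + k) up w by rewrite addnC.
by rewrite !iterD e e' !iter_up_g => /g_inj; lia.
Qed.

(** This says that [w] is within distance [D] of [g]: the path from [w] to the end meets [g] first
    at the point of [g] nearest to [w], and stays on it. *)
Definition depth_le D w := iter D up w = g (ht w - D%:Z).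

Lemma depth_le_ex w : exists D, depth_le D w.
Proof.
have [k [i ki]] := up_reach w; exists k.
have ki' : iter k up w = g (i + k%:Z - k%:Z) by rewrite addrK.
by rewrite /depth_le (ht_uniq ki').
Qed.

Lemma ht_g i : ht (g i) = i.
Proof. by apply: (@ht_uniq _ _ 0); rewrite subr0. Qed.

Lemma depth_le_g D i : depth_le D (g i).
Proof. by rewrite /depth_le iter_up_g ht_g. Qed.

Lemma depth_le_leq D D' w : (D <= D')%N -> depth_le D w -> depth_le D' w.
Proof.
rewrite /depth_le => /subnK <- e; rewrite iterD e iter_up_g; congr g; lia.
Qed.

Lemma ht_up w : ht (up w) = ht w - 1.
Proof.
have [D /(depth_le_leq (leqnSn D))] := depth_le_ex w; rewrite /depth_le iterSr => e.
by apply: (@ht_uniq _ _ D); rewrite e; congr g; lia.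
Qed.

Lemma ht_iter_up k w : ht (iter k up w) = ht w - k%:Z.
Proof. by elim: k => [|k /=]; rewrite ?subr0 // ht_up; lia. Qed.

Lemma depth_le_up D w : depth_le D w -> depth_le D (up w).
Proof.
move=> /(depth_le_leq (leqnSn D)); rewrite /depth_le iterSr => ->; rewrite ht_up; congr g; lia.
Qed.

Lemma depth_le_iter_up D k w : depth_le D w -> depth_le D (iter k up w).
Proof. by move=> nw; elim: k => //= k; apply: depth_le_up. Qed.

Lemma depth_le0 w : depth_le 0 w <-> w = g (ht w).
Proof. by rewrite /depth_le /= subr0. Qed.

Lemma depth_le_pred D w : depth_le D (up w) -> depth_le D.+1 w.
Proof. by rewrite /depth_le iterSr => ->; rewrite ht_up; congr g; lia. Qed.

Lemma adj_ht w w' : adj w w' -> `|ht w - ht w'| = 1.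
Proof. by move/adj_upP => [->|->]; rewrite ht_up; lia. Qed.

Lemma walk_ht w p : `|ht w - ht (walk w p)| <= (size p)%:Z.
Proof.
elim: p => [|i p IH] /=; first by lia.
have : adj (walk w p) (tree_act i (walk w p)) by exists i.
by move/adj_ht; lia.
Qed.

Lemma tree_dist_ht w w' : `|ht w - ht w'| <= (tree_dist w w')%:Z.
Proof. by have [p <- <-] := tree_dist_walk w w'; exact: walk_ht. Qed.

(** Along a walk leaving [g], a step to the parent does not increase the depth and a step to a child
    increases it by at most one. *)
Lemma depth_le_dist D w i : (tree_dist w (g i) <= D)%N -> depth_le D w.
Proof.
rewrite tree_distC => H; apply: depth_le_leq H _.
have [p <- <-] := tree_dist_walk (g i) w; elim: p => [|j p IH] /=; first exact: depth_le_g.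
have /adj_upP[->|e] : adj (walk (g i) p) (tree_act j (walk (g i) p)) by exists j.
  exact: depth_le_leq (leqnSn _) (depth_le_up IH).
by apply: depth_le_pred; rewrite -e.
Qed.

Lemma tree_dist_iter_up k w : (tree_dist w (iter k up w) <= k)%N.
Proof.
elim: k => [|k /=]; first by rewrite tree_distxx.
have /adj_dist := adj_up (iter k up w).
by have := tree_dist_trans (iter k up w) w (up (iter k up w)); lia.
Qed.

Lemma tree_dist_g i j : (tree_dist (g i) (g j))%:Z = `|i - j|.
Proof.
have := tree_dist_ht (g i) (g j); rewrite !ht_g.
have H a b : b <= a -> (tree_dist (g a) (g b))%:Z <= a - b.
  move=> ba; have := tree_dist_iter_up `|a - b|%N (g a); rewrite iter_up_g.
  by have -> : a - `|a - b|%N%:Z = b; lia.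
have [/H|/ltW/H] := leP j i; last rewrite tree_distC; lia.
Qed.

(* Two vertices joined by a walk of length [l] have the same ancestors at
   levels far enough up; this is what the extension theorem needs of a tree. *)
Definition compat (l : nat) w w' :=
  `|ht w - ht w'| <= l%:Z /\
  forall k k' : nat, (l <= k + k')%N -> ht w - k%:Z = ht w' - k'%:Z ->
    iter k up w = iter k' up w'.

(** Induction on the walk: each step trades one unit of its length against one level of [k']. When
    the last step is to a child, [k'] is positive since heights change by at most one per step. *)
Lemma compat_dist w w' l : (tree_dist w w' <= l)%N -> compat l w w'.
Proof.
move=> dl; split; first by have := tree_dist_ht w w'; lia.
move=> k k' kk; have {dl kk} : (tree_dist w w' <= k + k')%N by exact: leq_trans kk.
have [p <- <-] := tree_dist_walk w w'; elim: p k k' => [|i p IH] k k' /= le_k e.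
  by have -> : k = k' by lia.
have /adj_upP[u|u] : adj (walk w p) (tree_act i (walk w p)) by exists i.
  rewrite u -iterSr; apply: IH; first by lia.
  by move: e; rewrite u ht_up; lia.
have hu := congr1 ht u; rewrite ht_up in hu.
case: k' le_k e => [|k'] le_k e; first by have := walk_ht w p; lia.
by rewrite iterSr -u; apply: IH; lia.
Qed.

(** The bound forces both [k] and [k'] to be at least [D], so both ancestors are on [g], at the same
    height. This criterion handles pairs separated by a gap; [compat_dist] handles pairs in one
    strip. *)
Lemma compat_depth D w w' (l : nat) : depth_le D w -> depth_le D w' ->
  `|ht w - ht w'| + 2 * D%:Z <= l%:Z -> compat l w w'.
Proof.
move=> nw nw' le_l; split=> [|k k' kk e]; first by lia.
have Dk : (D <= k)%N by lia.
have Dk' : (D <= k')%N by lia.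
by rewrite (depth_le_leq Dk nw) (depth_le_leq Dk' nw') e.
Qed.

Definition shifts f c := equivariant f /\ forall i, f (g i) = g (i + c).

(** A translation of [g] fixes the end g(-oo). In the induction on depth, if [f] turned the edge
    from [w] to its parent upside down, the induction hypothesis for that parent would give
    [up (up w) = w]. *)
Lemma shifts_up f c w : shifts f c -> f (up w) = up (f w).
Proof.
move=> [ef fg]; have [D] := depth_le_ex w; elim: D w => [|D IH] w.
  by move/depth_le0 ->; rewrite up_g !fg up_g; congr g; lia.
move=> nw; have {}IH : f (up (up w)) = up (f (up w)).
  by apply: IH; move: nw; rewrite /depth_le iterSr => ->; rewrite ht_up; congr g; lia.
have /(adj_equivariant _ _ ef) /adj_upP[//|u] := adj_up w.
have : up (up w) = w by apply: (equivariant_inj ef); rewrite IH -u.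
by move/(congr1 ht); rewrite !ht_up; lia.
Qed.

Lemma shifts_iter_up f c w k : shifts f c -> f (iter k up w) = iter k up (f w).
Proof. by move=> sf; elim: k => //= k <-; rewrite (shifts_up _ sf). Qed.

Lemma shifts_ht f c w : shifts f c -> ht (f w) = ht w + c.
Proof.
move=> sf; have [D nw] := depth_le_ex w; apply: (@ht_uniq _ _ D).
by rewrite -(shifts_iter_up _ _ sf) nw (proj2 sf); congr g; lia.
Qed.

Lemma shifts_depth f c w D : shifts f c -> depth_le D w -> depth_le D (f w).
Proof.
move=> sf; rewrite /depth_le => nw.
by rewrite -(shifts_iter_up _ _ sf) nw (proj2 sf) (shifts_ht _ sf); congr g; lia.
Qed.

Lemma shifts_compat f c l w w' : shifts f c -> compat l w w' -> compat l (f w) (f w').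
Proof.
move=> sf [c1 c2]; split; rewrite !(shifts_ht _ sf); first by lia.
by move=> k k' kk e; rewrite -!(shifts_iter_up _ _ sf) (c2 k k') //; lia.
Qed.

Lemma shifts_comp f c f' c' : shifts f c -> shifts f' c' -> shifts (f \o f') (c' + c).
Proof.
move=> [ef fg] [ef' fg']; split; first exact: equivariant_comp.
by move=> i /=; rewrite fg' fg addrA.
Qed.

Lemma shifts_eq f c f' : shifts f c -> shifts f' c -> f =1 f'.
Proof. by move=> [ef fg] [ef' fg']; apply: (equivariant_eq (w := g 0)); rewrite ?fg ?fg'. Qed.

(** The relation holds at 0 by choice of the right factor; equality of the colours one period apart
    carries it along [g] in both directions. *)
Lemma shifts_period q : colour_period g q -> shifts (rmul (g q%:Z)) q%:Z.
Proof.
move=> [q0 qP]; set f := rmul _; have ef : equivariant f := @rmul_equivariant _ _; split=> // i.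
have f0 : f (g 0) = g (0 + q%:Z) by rewrite add0r g0 /f rmul_root.
have step j : f (g j) = g (j + q%:Z) <-> f (g (j + 1)) = g (j + 1 + q%:Z).
  have [a ca ga] := colour_adj (geodesic_adj j).
  have := qP j; rewrite ca => /colourP; rewrite addrAC => ga'.
  rewrite ga ef ga'; split=> [->//|e].
  by rewrite -[LHS](tree_actK a) e tree_actK.
elim: i => [//|n IH|n IH].
  by have := (step n%:Z).1 IH; rewrite -[n.+1]addn1 PoszD.
by apply/(step (- n.+1%:Z)).2; rewrite -[n.+1]addn1 PoszD opprD subrK.
Qed.

Variable q : nat.
Hypothesis q_period : colour_period g q.

(* For [q] dividing [c], the colour-preserving translation of [g] by [c]. *)
Definition gshift (c : int) : tree d -> tree d := rmul (g c).

(** A power of the translation by [q] sends the root to [g c], and only one equivariant map does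
    so. *)
Lemma gshiftP c : (q%:Z %| c)%Z -> shifts (gshift c) c.
Proof.
have S1 : shifts (gshift q%:Z) q%:Z := shifts_period q_period.
have [f' [ef' fK f'K]] := equivariant_inv (proj1 S1).
have S1' : shifts f' (- q%:Z).
  by split=> // i; rewrite -{1}(subrK q%:Z i) -(proj2 S1) fK.
have ex (a : int) : exists f, shifts f (a * q%:Z).
  elim: a => [|n [f sf]|n [f sf]].
  - by exists id; split=> [//|i]; rewrite mul0r addr0.
  - exists (gshift q%:Z \o f); have := shifts_comp S1 sf; congr shifts; lia.
  - exists (f' \o f); have := shifts_comp S1' sf; congr shifts; lia.
case/dvdzP => a ->; have [f sf] := ex a; split=> [|i]; first exact: rmul_equivariant.
rewrite -(proj2 sf); apply: (equivariant_eq (w := tree_root d)).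
- exact: rmul_equivariant.
- exact: (proj1 sf).
- by rewrite /gshift rmul_root -g0 (proj2 sf) add0r.
Qed.

Lemma gshiftD c c' w : (q%:Z %| c)%Z -> (q%:Z %| c')%Z ->
  gshift (c + c') w = gshift c (gshift c' w).
Proof.
move=> qc qc'; apply: (shifts_eq (c := c + c') (f' := gshift c \o gshift c')).
  by apply: gshiftP; exact: rpredD.
by rewrite addrC; apply: shifts_comp; exact: gshiftP.
Qed.

Lemma gshift0 w : gshift 0 w = w.
Proof.
by apply: (shifts_eq (c := 0) (f' := id)); [exact/gshiftP/dvdz0 | split=> // i; rewrite addr0].
Qed.

Lemma gshift_inj c : injective (gshift c).
Proof. exact/equivariant_inj/rmul_equivariant. Qed.

End End.

(** * Extension of tree-valued maps on the lattice *)

Section Lattice.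
Variable m : nat.
Implicit Types (x y z : 'rV[int]_m) (k : 'I_m).

Definition nrm x : nat := (\sum_(k < m) `|x 0%R k|)%N.
(** Its parity is the two-colouring of the lattice, with which the parity of heights must agree. *)
Definition zsum x : int := \sum_k x 0 k.

Lemma nrm0 : nrm 0 = 0%N.
Proof. by rewrite /nrm big1 // => k _; rewrite mxE. Qed.

Lemma nrmN x : nrm (- x) = nrm x.
Proof. by apply: eq_bigr => k _; rewrite mxE abszN. Qed.

Lemma nrmB x y : nrm (x - y) = nrm (y - x).
Proof. by rewrite -nrmN opprB. Qed.

Lemma nrmD x y : (nrm (x + y) <= nrm x + nrm y)%N.
Proof. by rewrite /nrm -big_split /= leq_sum // => k _; rewrite mxE; move: (x 0 k) (y 0 k) => a b; lia. Qed.

Lemma nrm_trans x y z : (nrm (x - z) <= nrm (x - y) + nrm (y - z))%N.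
Proof. by have := nrmD (x - y) (y - z); rewrite addrA subrK. Qed.

Lemma nrm_eq0 x : nrm x = 0%N -> x = 0.
Proof.
move/eqP; rewrite /nrm sum_nat_eq0 => /forallP x0; apply/rowP => k.
by have := x0 k; rewrite mxE /= absz_eq0 => /eqP.
Qed.

Lemma zsumD x y : zsum (x + y) = zsum x + zsum y.
Proof. by rewrite /zsum -big_split; apply: eq_bigr => k _; rewrite mxE. Qed.

Lemma zsumN x : zsum (- x) = - zsum x.
Proof. by rewrite /zsum -sumrN; apply: eq_bigr => k _; rewrite mxE. Qed.

Lemma zsumB x y : zsum (x - y) = zsum x - zsum y.
Proof. by rewrite zsumD zsumN. Qed.

Lemma zsum0 : zsum 0 = 0.
Proof. by rewrite /zsum big1 // => k _; rewrite mxE. Qed.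

Lemma nrm_zsum x : (2 %| (nrm x)%:Z - zsum x)%Z.
Proof.
rewrite /nrm /zsum (big_morph Posz PoszD (erefl _)) -sumrB.
apply: rpred_sum => k _; move: (x 0 k) => a; change (2 %| `|a|%:Z - a)%Z; lia.
Qed.

Lemma l1norm_nrm x : l1norm x = (nrm x)%:Z.
Proof.
by rewrite /l1norm /nrm (big_morph Posz PoszD (erefl _)); apply: eq_bigr.
Qed.

Lemma zadj_nrm x y : zadj x y <-> nrm (x - y) = 1%N.
Proof. by rewrite /zadj l1norm_nrm; split=> [[]|->]. Qed.

Lemma zadjC x y : zadj x y -> zadj y x.
Proof. by rewrite !zadj_nrm nrmB. Qed.

Lemma zadj_trans x y z : zadj (x + z) (y + z) <-> zadj x y.
Proof. by rewrite !zadj_nrm opprD addrACA subrr addr0. Qed.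

Lemma zbasisE k (j : 'I_m) : zbasis k 0 j = (j == k)%:R.
Proof. by rewrite /zbasis mxE eqxx. Qed.

Lemma nrm_pull x k : x 0 k != 0 ->
  (nrm (x - zbasis k *~ sgz (x 0 k))).+1 = nrm x.
Proof.
move=> xk; rewrite /nrm (bigD1 k) //= [RHS](bigD1 k) //= -addSn; congr addn.
  by rewrite !mxE -scaler_int mxE zbasisE eqxx; move: (x 0 k) xk => a; case: sgzP; lia.
apply: eq_bigr => j /negbTE jk; rewrite !mxE -scaler_int mxE zbasisE jk mulr0 subr0.
by [].
Qed.

Lemma zadj_basis x k : zadj x (x + zbasis k).
Proof.
apply/zadj_nrm; rewrite opprD addrA subrr add0r nrmN /nrm (bigD1 k) //= big1 ?addn0.
  by rewrite zbasisE eqxx.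
by move=> j /negbTE jk; rewrite zbasisE jk.
Qed.

Lemma zadj_basisP x y : zadj x y ->
  exists k, y = x + zbasis k \/ x = y + zbasis k.
Proof.
move/zadj_nrm => xy1; have [k] : exists k, (x - y) 0 k != 0.
  apply/existsP; apply: contra_eqT xy1 => /existsPn H; rewrite /nrm big1 // => k _.
  by move: (H k); rewrite negbK => /eqP ->.
move=> /[dup] xyk /nrm_pull; rewrite xy1 => -[/nrm_eq0/subr0_eq e].
exists k; move: xyk e; move: ((x - y) 0 k) => a; case: sgzP => // _ _.
  by rewrite mulr1z => <-; right; rewrite addrC subrK.
by rewrite mulrN1z => e; left; rewrite -[zbasis k]opprK -e opprB addrC subrK.
Qed.

Lemma zadj_pull x k : x 0 k != 0 -> zadj (x - zbasis k *~ sgz (x 0 k)) x.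
Proof.
move: (x 0 k) => a; case: sgzP => // _ _.
  by rewrite mulr1z; have := zadj_basis (x - zbasis k) k; rewrite subrK.
by rewrite mulrN1z opprK; apply/zadjC/zadj_basis.
Qed.

Lemma nrm_step x y n : nrm (y - x) = n.+1 ->
  exists2 z, zadj z y & nrm (z - x) = n.
Proof.
move=> e; have [k xk] : exists k, (y - x) 0 k != 0.
  apply/existsP; apply: contra_eqT e => /existsPn H; rewrite /nrm big1 // => k _.
  by move: (H k); rewrite negbK => /eqP ->.
have := zadj_pull xk; have := nrm_pull xk; set v := zbasis k *~ _; rewrite e => -[e'] a.
exists (y - v); last by rewrite addrAC.
by apply/(zadj_trans _ _ (- x)); rewrite addrAC.
Qed.

Lemma lattice_ind (P : 'rV[int]_m -> Prop) x :
  P x -> (forall y z, P y -> zadj y z -> P z) -> forall y, P y.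
Proof.
move=> Px PS y; move e : (nrm (y - x)) => n; elim: n y e => [|n IH] y.
  by move/nrm_eq0/subr0_eq ->.
by move/nrm_step => [z zy /IH Pz]; exact: PS zy.
Qed.

Lemma graph_hom_dist d (h : 'rV[int]_m -> tree d) x y :
  graph_hom h -> (tree_dist (h x) (h y) <= nrm (y - x))%N.
Proof.
move=> hh; move e : (nrm (y - x)) => n; elim: n y e => [|n IH] y.
  by move/nrm_eq0/subr0_eq ->; rewrite tree_distxx.
move/nrm_step => [z zy /IH le_n]; have := tree_dist_trans (h z) (h x) (h y).
by have := hh _ _ zy; lia.
Qed.

Lemma graph_hom_adj d (h : 'rV[int]_m -> tree d) :
  graph_hom h <-> forall x y, zadj x y -> adj (h x) (h y).
Proof. by split=> H x y /H /adj_dist. Qed.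

End Lattice.

Section Extension.
Variables (m d : nat) (g : int -> tree d).
Hypothesis g_geodesic : two_sided_geodesic g.
Hypothesis g0 : g 0 = tree_root d.
Variables (A : set 'rV[int]_m) (val : 'rV[int]_m -> tree d) (a0 : 'rV[int]_m).
Hypothesis A0 : A a0.
Hypothesis A_compat : forall y y', A y -> A y' -> compat g (nrm (y - y')) (val y) (val y').
Hypothesis A_parity : forall y, A y -> (2 %| ht g (val y) - zsum y)%Z.
Implicit Types (x y : 'rV[int]_m).

Local Notation height x y := (ht g (val y) - (nrm (x - y))%:Z).

(* McShane's formula, with respect to the order of the tree rooted at its end
   [g(-oo)]: among the ancestors of the [val y] at distance [nrm (x - y)], all
   the highest ones coincide. *)
Definition witness x y := A y /\ forall y', A y' -> height x y' <= height x y.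

Definition ext x : tree d :=
  let y := xget a0 [set y | witness x y] in iter (nrm (x - y)) (up g) (val y).

(** Compatibility with [a0] and the triangle inequality bound all the heights by [B], so their
    integer maximum is attained. *)
Lemma witness_ex x : exists y, witness x y.
Proof.
pose B := ht g (val a0) + (nrm (x - a0))%:Z.
have le_B y : A y -> height x y <= B.
  move=> Ay; have := proj1 (A_compat Ay A0); have := nrm_trans y x a0.
  by rewrite (nrmB y x) /B; lia.
pose S := [set j | exists2 y, A y & `|B - height x y|%N = j].
have [y Ay e] : S (natmin S).
  by apply: (@natmin_mem S `|B - height x a0|%N); exists a0.
exists y; split=> // y' Ay'.
have /natmin_le : S `|B - height x y'|%N by exists y'.
by rewrite -e; have := le_B _ Ay; have := le_B _ Ay'; lia.
Qed.

(** Two maximisers have ancestors at the same level, and the two numbers of levels climbed add up to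
    at least their distance, by the triangle inequality through [x]. Compatibility identifies the
    ancestors. *)
Lemma extE x y : witness x y -> ext x = iter (nrm (x - y)) (up g) (val y).
Proof.
move=> wy; rewrite /ext; case: xgetP => [y' _ wy'|/(_ y)//].
have [Ay Hy] := wy; have [Ay' Hy'] := wy'.
apply: (proj2 (A_compat Ay' Ay)); last by have := Hy _ Ay'; have := Hy' _ Ay; lia.
by rewrite -(nrmB y' x); exact: nrm_trans.
Qed.

Lemma ext_on y : A y -> ext y = val y.
Proof.
move=> Ay; rewrite (@extE y y) ?subrr ?nrm0 //; split=> // y' Ay'.
by rewrite subrr nrm0; have := proj1 (A_compat Ay Ay'); lia.
Qed.

Lemma ext_ht x y : witness x y -> ht g (ext x) = height x y.
Proof. by move=> wy; rewrite (extE wy) ht_iter_up. Qed.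

Lemma ext_parity x : (2 %| ht g (ext x) - zsum x)%Z.
Proof.
have [y wy] := witness_ex x; rewrite (ext_ht wy).
have := A_parity (proj1 wy); have := nrm_zsum (x - y); rewrite zsumB; lia.
Qed.

(** If [x'] is the higher of two neighbours, its witness also serves [x], one level further up, so
    the values are parent and child. Parity excludes equal heights. *)
Lemma ext_hom : graph_hom ext.
Proof.
have step x x' : zadj x x' -> ht g (ext x) < ht g (ext x') -> adj (ext x) (ext x').
  move=> xx' lt_h; have /zadj_nrm n1 := xx'.
  have [y wy] := witness_ex x; have [y' wy'] := witness_ex x'.
  have := nrm_trans x x' y'; have := nrm_trans x' x y; rewrite (nrmB x' x) n1 => le1 le2.
  have := proj2 wy _ (proj1 wy'); have := proj2 wy' _ (proj1 wy).
  move: lt_h; rewrite (ext_ht wy) (ext_ht wy') => lt_h Hy Hy'.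
  have wxy' : witness x y'.
    by split=> [|z Az]; [exact: (proj1 wy') | have := proj2 wy z Az; lia].
  rewrite (extE wxy') (extE wy').
  have -> : nrm (x - y') = (nrm (x' - y')).+1 by lia.
  exact/adjC/adj_up.
apply/graph_hom_adj => x x' xx'.
have [lt_h|lt_h|e] := ltgtP (ht g (ext x)) (ht g (ext x')).
- exact: step.
- exact/adjC/step/lt_h/zadjC.
- have := ext_parity x; have := ext_parity x'; have := nrm_zsum (x - x').
  by have /zadj_nrm -> := xx'; rewrite zsumB e; lia.
Qed.

Lemma ext_depth D x : (forall y, A y -> depth_le g D (val y)) -> depth_le g D (ext x).
Proof.
move=> nD; have [y wy] := witness_ex x; rewrite (extE wy).
by apply: depth_le_iter_up => //; apply/nD/(proj1 wy).
Qed.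

(** Translating the data carries witnesses to witnesses, and [f] commutes with taking ancestors. *)
Lemma ext_shift v f c : shifts g f c ->
  (forall y, A (y + v) <-> A y) -> (forall y, A y -> val (y + v) = f (val y)) ->
  forall x, ext (x + v) = f (ext x).
Proof.
move=> sf Av valv x; have [y wy] := witness_ex x; have [Ay Hy] := wy.
have B z z' : z + v - (z' + v) = z - z' by rewrite opprD addrACA subrr addr0.
rewrite (extE wy) (@extE (x + v) (y + v)).
  by rewrite B valv // (shifts_iter_up g_geodesic g0 _ _ sf).
split=> [|y' Ay']; first exact/Av.
have e : y' = y' - v + v by rewrite subrK.
have Ay'v : A (y' - v) by apply/Av; rewrite -e.
have n' : nrm (x + v - y') = nrm (x - (y' - v)) by rewrite {1}e B.
have h' : ht g (val y') = ht g (val (y' - v)) + c.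
  by rewrite {1}e valv // (shifts_ht g_geodesic g0 _ sf).
have := Hy _ Ay'v; rewrite B valv // (shifts_ht g_geodesic g0 _ sf) n' h'; lia.
Qed.

End Extension.

(** * Translations of the image *)

Section Axis.
Variables (m d : nat) (g : int -> tree d).
Hypothesis g_geodesic : two_sided_geodesic g.
Hypothesis g0 : g 0 = tree_root d.
Variable h : 'rV[int]_m -> tree d.
Hypothesis h_hom : graph_hom h.
Local Notation root := (tree_root d).

(** The last letter of a word is the first generator applied, so it names the branch at [h x]
    containing [h x']. A connected image can enter this branch only through its first vertex. *)
Lemma image_first_step f x x' v s a : equivariant f -> h x = f root -> h x' = f v ->
  sval v = rcons s a -> exists x1, h x1 = tree_act a (h x).
Proof.
move=> ef hx; have [f' [_ fK f'K]] := equivariant_inv ef.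
move: v s a; apply: (@lattice_ind _ (fun y => forall v s a, h y = f v ->
  sval v = rcons s a -> exists x1, h x1 = tree_act a (h x)) x).
  by move=> v s a; rewrite hx => /(equivariant_inj ef) <- /=; case: s.
move=> y z IH yz v s a hz vs; have [i zi] := (graph_hom_adj h).1 h_hom _ _ yz.
have hy : h y = f (f' (h y)) by rewrite f'K.
have vi : v = tree_act i (f' (h y)).
  by apply: (equivariant_inj ef); rewrite ef -hy -hz.
move: vs; rewrite vi /=; case us : (sval (f' (h y))) => [|j u] /=.
  case: s => [|? [|]] //= [<-]; exists z; rewrite zi; congr tree_act.
  by rewrite hx hy; congr f; apply: tree_inj.
case: eqVneq => [_ e|_].
  by apply: (IH (f' (h y)) (j :: s)) => //; rewrite us e.
case: s => [|i' s] //= [_ e].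
by apply: (IH (f' (h y)) s) => //; rewrite us e.
Qed.

(** Starting from [x'], the image stays beyond [h x'], among words with suffix [b :: s], until it
    crosses the edge coloured [b]; it must cross it in order to reach [h x]. *)
Lemma image_last_step f x x' v s b : equivariant f -> h x = f root -> h x' = f v ->
  sval v = b :: s -> exists x2, h x2 = tree_act b (h x').
Proof.
move=> ef hx hx' vs; have [f' [_ fK f'K]] := equivariant_inv ef.
suff : (exists x2, h x2 = tree_act b (h x')) \/ exists u, sval (f' (h x)) = u ++ b :: s.
  by case=> // -[u]; rewrite hx fK /=; case: u.
apply: (@lattice_ind _ (fun y => (exists x2, h x2 = tree_act b (h x')) \/
  exists u, sval (f' (h y)) = u ++ b :: s) x').
  by right; exists [::]; rewrite hx' fK.
move=> y z [|[u yu]] yz; first by left.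
have [i zi] := (graph_hom_adj h).1 h_hom _ _ yz.
have hy : h y = f (f' (h y)) by rewrite f'K.
have zE : f' (h z) = tree_act i (f' (h y)) by rewrite zi hy -ef !fK.
case: u yu => [|j u] /= yu.
  have [ib|ib] := eqVneq i b.
    left; exists z; rewrite zi ib; congr tree_act.
    by rewrite hx' hy; congr f; apply: tree_inj; rewrite yu vs.
  by right; exists [:: i]; rewrite zE /= yu /= (negbTE ib).
right; rewrite zE /= yu /=; case: ifP => _; first by exists u.
by exists [:: i, j & u].
Qed.

Lemma image_geodesic x x' : (2 <= tree_dist (h x) (h x'))%N ->
  exists a b x1 x2, [/\ h x1 = tree_act a (h x), h x2 = tree_act b (h x'),
    (tree_dist (h x1) (h x') < tree_dist (h x) (h x'))%N,
    (tree_dist (h x) (h x2) < tree_dist (h x) (h x'))%N &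
    ((tree_dist (h x1) (h x2)).+1 < tree_dist (h x) (h x'))%N].
Proof.
have [f ef fr] := equivariant_ex root (h x); have [f' [_ fK f'K]] := equivariant_inv ef.
have hx' : h x' = f (f' (h x')) by rewrite f'K.
move: (f' (h x')) hx' => v hx'.
rewrite hx' -fr tree_dist_equivariant // tree_dist_root.
case vb : (sval v) => [|b s] //=; case/lastP: s vb => // s a vs; rewrite size_rcons => _.
have [x1 h1] := image_first_step ef (esym fr) hx' (s := b :: s) vs.
have [x2 h2] := image_last_step ef (esym fr) hx' vs.
have w1 : walk (h x1) s = h x2.
  have vE : v = tree_act b (walk (tree_act a root) s).
    by rewrite -[LHS]walk_root vs -cats1 /walk /= foldr_cat.
  by rewrite h1 h2 hx' vE ef tree_actK equivariant_walk // ef fr.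
exists a, b, x1, x2; split; rewrite ?fr -?hx' //.
- have := tree_dist_le (h x1) (b :: s); rewrite [walk _ _]/= -/(walk _ _) w1 h2 tree_actK.
  by rewrite /=; lia.
- have -> : h x2 = walk (h x) (rcons s a) by rewrite -cats1 walk_cat /= -w1 h1.
  by have := tree_dist_le (h x) (rcons s a); rewrite size_rcons; lia.
- by rewrite -w1; have := tree_dist_le (h x1) s; lia.
Qed.

Variables (R : tree d -> tree d) (v : 'rV[int]_m) (D : nat).
Hypothesis R_equivariant : equivariant R.
Hypothesis hR : forall x, h (x + v) = R (h x).
Hypothesis h_depth : forall x, depth_le g D (h x).

Local Notation tau := (natmin (range (fun x => tree_dist (h x) (h (x + v))))).

(* The axis of [R]: each of its points in the image of [h] has two neighbours
   on it, so a point at maximal distance from [g] lies on [g]. *)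
Lemma displacement_shifts : tau != 1%N -> exists2 c : int, `|c|%N = tau & shifts g R c.
Proof.
have tau_le x : (tau <= tree_dist (h x) (R (h x)))%N.
  by rewrite -hR; apply: natmin_le; exists x.
have [x0 _ x0P] : range (fun x => tree_dist (h x) (h (x + v))) tau.
  by apply: (@natmin_mem _ (tree_dist (h 0) (h (0 + v)))); exists 0.
move: (tau) tau_le x0P => t t_le x0P t1; rewrite hR in x0P.
(* A zero displacement gives a fixed point, and an equivariant map with a fixed point is the
   identity. *)
have [t0|t2] : t = 0%N \/ (2 <= t)%N by lia.
  move: x0P; rewrite t0 => /tree_dist0 e; exists 0 => //; split=> // i.
  by rewrite addr0; apply: (equivariant_eq (f' := id) R_equivariant _ (esym e)).
pose S w := exists2 x, h x = w & tree_dist w (R w) = t.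
(* The neighbours are the first vertex on the path from [w] to [R w] and the preimage under [R] of
   the last one. Were their colours equal, the first one would be displaced by less than [t]. *)
have S_step w : S w -> exists a b, [/\ a != b, S (tree_act a w) & S (tree_act b w)].
  case=> x hx dw; have /image_geodesic[] : (2 <= tree_dist (h x) (h (x + v)))%N by rewrite hR hx dw.
  move=> a [b [x1 [x2 [h1 h2 d1 d2 d12]]]].
  rewrite !(hR, hx) in h1 h2 d1 d2 d12; rewrite !dw in d1 d2 d12.
  have adj1 u c : tree_dist u (tree_act c u) = 1%N by apply/adj_dist; exists c.
  have h2v : h (x2 - v) = tree_act b w.
    by apply: (equivariant_inj R_equivariant); rewrite -hR subrK h2 R_equivariant.
  exists a, b; split.
  - apply/eqP => ab; have := t_le x1.
    have -> : R (h x1) = h x2 by rewrite h1 R_equivariant h2 ab.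
    by lia.
  - exists x1 => //; rewrite -h1; apply/eqP; rewrite eqn_leq t_le andbT.
    have := tree_dist_trans (R w) (h x1) (R (h x1)).
    have -> : tree_dist (R w) (R (h x1)) = 1%N by rewrite tree_dist_equivariant // h1 adj1.
    by lia.
  - exists (x2 - v) => //; rewrite -h2v; apply/eqP; rewrite eqn_leq t_le andbT.
    have := tree_dist_trans w (h (x2 - v)) (R (h (x2 - v))).
    have -> : tree_dist (h (x2 - v)) w = 1%N by rewrite h2v tree_distC adj1.
    by rewrite -hR subrK; lia.
have S_g w : S w -> w = g (ht g w).
  suff Sd k : (forall w, S w -> depth_le g k w) -> forall w, S w -> depth_le g 0 w.
    by move=> /Sd H; apply/depth_le0/H => u [x <- _]; exact: h_depth.
  elim: k => // k IH Sk; apply: IH => u Su.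
  have [a [b [ab Sa Sb]]] := S_step _ Su.
  have [c Sc uc] : exists2 c, S (tree_act c u) & u = up g (tree_act c u).
    have /(adj_upP g_geodesic g0)[ua|ua] : adj u (tree_act a u) by exists a.
      have /(adj_upP g_geodesic g0)[ub|ub] : adj u (tree_act b u) by exists b.
        by case/eqP: ab; apply: (@tree_act_inj _ _ _ u); rewrite ua ub.
      by exists b.
    by exists a.
  have := Sk _ Sc; rewrite /depth_le iterSr -uc => ->; congr g.
  by rewrite [in RHS]uc ht_up //; lia.
have Sx0 : S (h x0) by exists x0.
have S_next i : S (g i) -> S (g (i + 1)) /\ S (g (i - 1)).
  move=> /S_step[a [b [ab Sa Sb]]].
  have ht1 c : `|i - ht g (tree_act c (g i))| = 1.
    by have := @adj_ht _ _ g_geodesic g0 (g i) (tree_act c (g i)); rewrite ht_g //; apply; exists c.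
  have hab : ht g (tree_act a (g i)) != ht g (tree_act b (g i)).
    apply: contra ab => /eqP e; apply/eqP; apply: (@tree_act_inj _ _ _ (g i)).
    by rewrite (S_g _ Sa) (S_g _ Sb) e.
  have Sa' := Sa; have Sb' := Sb; rewrite (S_g _ Sa) in Sa'; rewrite (S_g _ Sb) in Sb'.
  move: Sa' Sb' hab (ht1 a) (ht1 b); move: (ht g _) (ht g _) => p r Sp Sr pr p1 r1.
  have [[rE pE]|[rE pE]] : (r = i + 1 /\ p = i - 1) \/ (p = i + 1 /\ r = i - 1) by lia.
    by rewrite -rE -pE.
  by rewrite -rE -pE.
have S_all i : S (g i).
  have S0 := Sx0; rewrite (S_g _ Sx0) in S0; move: (ht g _) S0 => j Sj.
  rewrite -(subrK j i); elim: (i - j) => [|n IH|n IH].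
  - by rewrite add0r.
  - by have := (S_next _ IH).1; rewrite addrAC -PoszD addn1.
  - have := (S_next _ IH).2; congr (S (g _)); lia.
pose e i := ht g (R (g i)).
have eP i : R (g i) = g (e i).
  apply: S_g; have [x hx dx] := S_all i; exists (x + v); first by rewrite hR hx.
  by rewrite tree_dist_equivariant.
have e_t i : `|i - e i| = t%:Z.
  by have [x _] := S_all i; rewrite eP -(tree_dist_g g_geodesic g0) => ->.
have e_adj i : `|e i - e (i + 1)| = 1.
  rewrite -(tree_dist_g g_geodesic g0) -!eP tree_dist_equivariant //.
  by rewrite (tree_dist_g g_geodesic g0); lia.
(* The two sides differ by 0 or 2 and both equal [t] up to sign; a change of sign would need a jump
   of 2t, which is at least 4. *)
have e_step i : e (i + 1) - (i + 1) = e i - i.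
  move: (e_t i) (e_t (i + 1)) (e_adj i) t2; move: (e i) (e (i + 1)) => p r.
  by lia.
exists (e 0); first by have := e_t 0; lia.
split=> // i; rewrite eP; congr g.
elim: i => [|n IH|n IH]; first by rewrite add0r.
  by have := e_step n; rewrite -PoszD addn1; lia.
have := e_step (- n.+1%:Z); have -> : - n.+1%:Z + 1 = - n%:Z by lia.
by lia.
Qed.

End Axis.

Lemma tree_dist_parity d (g : int -> tree d) (g_geodesic : two_sided_geodesic g)
    (g0 : g 0 = tree_root d) w w' :
  (2 %| ht g w - ht g w' - (tree_dist w w')%:Z)%Z.
Proof.
have [p <- <-] := tree_dist_walk w w'; elim: p => [|i p IH] /=; first by rewrite subrr.
have : adj (walk w p) (tree_act i (walk w p)) by exists i.
by move/(adj_ht g_geodesic g0); move: IH; lia.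
Qed.

Section Projection.
Variables (d : nat) (g : int -> tree d).

Lemma geod_projP w : exists2 i, geod_proj g w = g i &
  forall j, (tree_dist w (g i) <= tree_dist w (g j))%N.
Proof.
rewrite /geod_proj; case: xgetP => [i _ iP|none]; first by exists i.
pose A := range (fun i => tree_dist w (g i)).
have [i _ iA] : A (natmin A) by apply: (@natmin_mem A (tree_dist w (g 0))); exists 0.
exfalso; apply: (none i) => j; rewrite iA; apply: natmin_le; by exists j.
Qed.

Lemma geod_proj_le w i : (tree_dist w (geod_proj g w) <= tree_dist w (g i))%N.
Proof. by have [j -> H] := geod_projP w. Qed.

Lemma geod_proj_g i : geod_proj g (g i) = g i.
Proof.
by have := geod_proj_le (g i) i; rewrite tree_distxx leqn0 => /eqP/tree_dist0.
Qed.

End Projection.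

(** * Configurations with a signed slope, and their comparison with [Hset] *)

Section Frames.
Variables (m d : nat) (g : int -> tree d).
Hypothesis g_geodesic : two_sided_geodesic g.
Hypothesis g0 : g 0 = tree_root d.
Hypothesis g_periodic : periodic_geodesic g.
Local Notation q := (even_period g).
Implicit Types (h : 'rV[int]_m -> tree d) (n : nat) (t : 'I_m -> int) (k : 'I_m).

Lemma even_periodP : colour_period g q /\ ~~ odd q.
Proof.
have [p [p0 pP]] := g_periodic.
apply: (@natmin_mem [set q | colour_period g q /\ ~~ odd q] (p + p)%N).
split; last by rewrite oddD addbb.
by split=> [|i]; [lia | rewrite PoszD addrA !pP].
Qed.

Let shiftqP c : (q%:Z %| c)%Z -> shifts g (gshift g c) c.
Proof. exact: (gshiftP g_geodesic g0 even_periodP.1). Qed.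

Lemma even_period_gt0 : (0 < q)%N. Proof. by case: even_periodP => -[]. Qed.

Lemma dvdz_even_period c : (q%:Z %| c)%Z -> (2 %| c)%Z.
Proof. by apply: dvdz_trans; have [_] := even_periodP; lia. Qed.

Lemma translation_equivariant n h k : graph_hom h -> translation_invariant n h ->
  exists2 R, equivariant R & forall x, h (x + zbasis k *+ n) = R (h x).
Proof.
move=> hh hn; have [R eR R0] := equivariant_ex (h 0) (h (0 + zbasis k *+ n)).
exists R => //; apply: (@lattice_ind _ (fun x => h (x + zbasis k *+ n) = R (h x)) 0) => //.
move=> y z Ry yz; have [i ci ->] := colour_adj ((graph_hom_adj h).1 hh _ _ yz).
have := hn _ _ k yz; rewrite /dual_map ci => /esym/colourP ->.
by rewrite Ry eR.
Qed.

(* The configurations of [Hset] become frames after changing the signs of some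
   coordinates, as the slope in [Hset] is only prescribed up to sign. *)
Definition frame n t h := [/\ graph_hom h,
  forall x k, h (x + zbasis k *+ n) = gshift g (t k) (h x),
  forall x, depth_le g (m * n)./2 (h x),
  (2 %| ht g (h 0%R))%Z & `|ht g (h 0)| <= (m * n)./2.+1%:Z].

Lemma frame_mulz n t h x (c : 'rV[int]_m) : (forall k, (q%:Z %| t k)%Z) -> frame n t h ->
  h (x + c *+ n) = gshift g (\sum_k t k * c 0 k) (h x).
Proof.
move=> qt [_ hn _ _ _].
have dvd_sum (c' : 'rV[int]_m) : (q%:Z %| \sum_k t k * c' 0%R k)%Z.
  by apply: rpred_sum => k _; apply: dvdz_mulr.
have step x' (c' : 'rV[int]_m) k : h (x' + c' *+ n) = gshift g (\sum_k t k * c' 0 k) (h x') <->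
    h (x' + (c' + zbasis k) *+ n) = gshift g (\sum_j t j * (c' + zbasis k) 0 j) (h x').
  have -> : \sum_j t j * (c' + zbasis k) 0 j = t k + \sum_j t j * c' 0 j.
    rewrite (bigD1 k) //= [in RHS](bigD1 k) //= addrA; congr (_ + _).
      by rewrite mxE zbasisE eqxx mulrDr mulr1 addrC.
    by apply: eq_bigr => j /negbTE jk; rewrite mxE zbasisE jk addr0.
  rewrite mulrnDl addrA hn (gshiftD g_geodesic g0 even_periodP.1) //.
  by split=> [->//|/gshift_inj].
apply: (@lattice_ind _ (fun c => h (x + c *+ n) = gshift g (\sum_k t k * c 0 k) (h x)) 0).
  rewrite mul0rn addr0 big1 ?(gshift0 g_geodesic g0 even_periodP.1) // => k _.
  by rewrite mxE mulr0.
move=> y z Hy /zadj_basisP[k [->|e]]; first exact: (step x y k).1.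
by apply/(step x z k); rewrite -e.
Qed.

Definition mirror (e : {ffun 'I_m -> bool}) (x : 'rV[int]_m) : 'rV[int]_m :=
  \row_k (if e k then - x 0 k else x 0 k).

Lemma mirrorK e : involutive (mirror e).
Proof. by move=> x; apply/rowP => k; rewrite !mxE; case: (e k); rewrite ?opprK. Qed.

Lemma mirror0 e : mirror e 0 = 0.
Proof. by apply/rowP => k; rewrite !mxE oppr0 if_same. Qed.

Lemma nrm_mirror e x : nrm (mirror e x) = nrm x.
Proof. by apply: eq_bigr => k _; rewrite mxE; case: (e k) => //; rewrite abszN. Qed.

Lemma mirrorB e x y : mirror e (x - y) = mirror e x - mirror e y.
Proof. by apply/rowP => k; rewrite !mxE; case: (e k); rewrite ?opprD. Qed.

Lemma mirrorD_basis e x k n : mirror e (x + zbasis k *+ n) =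
  if e k then mirror e x - zbasis k *+ n else mirror e x + zbasis k *+ n.
Proof.
apply/rowP => j; case: ifP => ek; rewrite !mxE !mulmxnE !zbasisE.
  have [->|_] := eqVneq j k; first by rewrite ek opprD.
  by rewrite mul0rn subr0 addr0.
have [->|_] := eqVneq j k; first by rewrite ek.
by rewrite mul0rn !addr0.
Qed.

Lemma graph_hom_mirror e h : graph_hom h -> graph_hom (h \o mirror e).
Proof. by move=> hh x y /zadj_nrm xy; apply/hh/zadj_nrm; rewrite -mirrorB nrm_mirror. Qed.

Variables (R : realType).

Lemma dvdz_target n (s : 'rV[R]_m) k : (q%:Z %| target n g s k)%Z.
Proof. exact: dvdz_mulr. Qed.

(** The slope condition makes the least displacement of each period map equal to the absolute value
    of the target, so this map translates [g] by plus or minus the target; [e] reflects the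
    coordinates with the wrong sign. *)
Lemma Hset_frame n (s : 'rV[R]_m) h : (0 < n)%N -> Hset n g s h ->
  exists e, frame n (target n g s) (h \o mirror e).
Proof.
move=> n0 [hh hn hs hsup h0].
have hD x : depth_le g (m * n)./2 (h x).
  have [i pi _] := geod_projP g (h x); apply: (depth_le_dist g_geodesic g0 (i := i)).
  by rewrite -pi; have := hsup x; lia.
have ex k : exists c, shifts g (gshift g c) c /\ (`|c| = `|target n g s k| /\
    forall x, h (x + zbasis k *+ n) = gshift g c (h x)).
  have [Rk eR Rh] := translation_equivariant k hh hn.
  have tau : natmin (range (fun x => tree_dist (h x) (h (x + zbasis k *+ n)))) =
      `|target n g s k|%N.
    have := hs k; rewrite /slope => /mulIf.
    have n0' : (n%:R : R)^-1 != 0 by rewrite invr_eq0 pnatr_eq0 -lt0n.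
    by move=> /(_ n0') /eqP; rewrite -abszE -pmulrn eqr_nat => /eqP.
  have [|c ct sc] := displacement_shifts g_geodesic g0 hh eR Rh hD.
    (* The displacement is a multiple of the even period, hence not 1. *)
    by rewrite tau; have := dvdz_even_period (dvdz_target n s k); lia.
  have qc : (q%:Z %| c)%Z.
    by rewrite dvdzE ct tau -dvdzE dvdz_target.
  exists c; split; first exact: shiftqP.
  split=> [|x]; first by have := ct; rewrite tau; lia.
  by rewrite Rh; exact: (shifts_eq sc (shiftqP qc)).
have [c cP] := choice ex; pose e := [ffun k => c k != target n g s k].
exists e; split=> [|x k|x||] /=; rewrite ?mirror0 //; first exact: graph_hom_mirror.
- have [sc [ct hc]] := cP k; rewrite mirrorD_basis ffunE.
  case: eqVneq => [<-|ne] /=; first exact: hc.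
  have -> : target n g s k = - c k by lia.
  have qc : (q%:Z %| c k)%Z 
    by have := dvdz_target n s k; rewrite !dvdzE; have -> : `|c k|%N = `|target n g s k|%N by lia.
  have := hc (mirror e x - zbasis k *+ n); rewrite subrK => ->.
  have qNc : (q%:Z %| - c k)%Z by rewrite rpredN.
  rewrite -(gshiftD g_geodesic g0 even_periodP.1 _ qNc qc) addNr.
  by rewrite (gshift0 g_geodesic g0 even_periodP.1).
(* The rule for the projection of [h 0] puts it at even distance from [g 0] or at odd distance from
   [g 1]; its height is even in both cases. *)
- have [i pi _] := geod_projP g (h 0); rewrite pi in h0.
  have := tree_dist_parity g_geodesic g0 (h 0) (g i); rewrite ht_g //.
  by move: h0; case: ifP => o /(proj1 g_geodesic) e_i; rewrite e_i in o *; lia.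
- have [i pi _] := geod_projP g (h 0); have := hsup 0; rewrite pi in h0 *.
  have := tree_dist_ht g_geodesic g0 (h 0) (g i); rewrite ht_g //.
  by move: h0; case: ifP => _ /(proj1 g_geodesic) ->; lia.
Qed.

(** The displacement at 0 is the absolute value of the target, since [h 0] is on [g]; elsewhere it
    cannot be smaller, since heights already change by the target. *)
Lemma frame_Hset n (s : 'rV[R]_m) h : (0 < n)%N ->
  frame n (target n g s) h -> h 0 = g 0 -> Hset n g s h.
Proof.
move=> n0 [hh hn hD _ _] h0.
have sP k := shiftqP (dvdz_target n s k).
split=> //.
- move=> x y k xy; rewrite /dual_map !hn colour_equivariant //; exact: (proj1 (sP k)).
- move=> k; pose A := range (fun x => tree_dist (h x) (h (x + zbasis k *+ n))).
  have dE x : tree_dist (h x) (h (x + zbasis k *+ n)) =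
      tree_dist (h x) (gshift g (target n g s k) (h x)) by rewrite hn.
  have le1 : (natmin A <= `|target n g s k|)%N.
    apply: leq_trans (natmin_le (n := tree_dist (h 0) (h (0 + zbasis k *+ n))) _) _.
      by exists 0.
    rewrite dE h0 (proj2 (sP k)) add0r -lez_nat (tree_dist_g g_geodesic g0).
    by rewrite sub0r normrN.
  have [x _ xE] : A (natmin A).
    by apply: (@natmin_mem A (tree_dist (h 0) (h (0 + zbasis k *+ n)))); exists 0.
  have := tree_dist_ht g_geodesic g0 (h x) (h (x + zbasis k *+ n)).
  rewrite xE hn (shifts_ht g_geodesic g0 _ (sP k)) => le2.
  have AE : natmin A = `|target n g s k|%N by lia.
  by rewrite /slope -/A AE -abszE -pmulrn.
- move=> x; have := geod_proj_le g (h x) (ht g (h x) - (m * n)./2%:Z).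
  have := tree_dist_iter_up g_geodesic g0 (m * n)./2 (h x); rewrite (hD x); lia.
- by rewrite h0 geod_proj_g tree_distxx.
Qed.

End Frames.

(** * Samples agreeing on a skeleton *)

Section FiniteCounting.
Variable U : choiceType.

Lemma finite_code (K : finType) (A : set U) (code : U -> K) :
  (forall u v, A u -> A v -> code u = code v -> u = v) -> finite_set A.
Proof.
move=> inj; have [[u0 Au0]|/asboolPn/forallp_asboolPn A0] := pselect (exists u, A u); last first.
  by rewrite (_ : A = set0) //; apply/seteqP; split=> // u /A0.
apply: (@sub_finite_set _ _ ((fun k => xget u0 [set u | A u /\ code u = k]) @` [set: K])).
  move=> u Au; exists (code u) => //; case: xgetP => [v _ [Av e]|/(_ u)]; last by case.
  exact: inj.
exact/finite_image/finite_finset.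
Qed.

Lemma inj_card_fset_set (X : finType) (A : set U) (f : X -> U) :
  finite_set A -> injective f -> (forall x, A (f x)) -> (#|X| <= #|` fset_set A|)%N.
Proof.
move=> fA fi Af; rewrite cardE -(size_map f); apply: uniq_leq_size.
  by rewrite map_inj_uniq ?enum_uniq.
by move=> _ /mapP[x _ ->]; rewrite in_fset_set // inE.
Qed.

Lemma card_fset_setX (A : set U) : finite_set A ->
  (#|` fset_set (A `*` A)| <= #|` fset_set A| ^ 2)%N.
Proof.
move=> fA; rewrite fset_setX // -mulnn.
apply: leq_trans (_ : size (allpairs pair (fset_set A) (fset_set A)) <= _)%N; last first.
  by rewrite size_allpairs.
apply: uniq_leq_size => [|[u v]]; first exact: fset_uniq.
by rewrite in_fsetM => /andP[/= uA vA]; apply/allpairsP; exists (u, v).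
Qed.

(** The class is the fibre of the most frequent key. *)
Lemma pigeonhole_class (K : finType) (A : set U) (key : U -> K) : finite_set A ->
  exists N (f : 'I_N -> U), [/\ injective f, forall i, A (f i),
    forall i j, key (f i) = key (f j) & (#|` fset_set A| <= #|K| * N)%N].
Proof.
move=> fA; pose s := enum_fset (fset_set A); pose c k := [seq u <- s | key u == k].
have [s0|[u0 _]] : s = [::] \/ exists u, u \in s.
    by case: (s) => [|u r]; [left|right; exists u; rewrite inE eqxx].
  have no (T : Type) : 'I_0 -> T by move=> i; have := ltn_ord i.
  exists 0%N, (no U); split=> [i|i|i|]; [exact: no | exact: no | exact: no |].
  by rewrite (_ : #|` _| = size s) // s0.
have sum_c : size s = (\sum_k size (c k))%N.
  rewrite -sum1_size (partition_big key xpredT) //; apply: eq_bigr => k _.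
  by rewrite size_filter -sum1_count.
have [k kmax] : exists k, (size s <= #|K| * size (c k))%N.
  pose k := [arg max_(k > key u0) size (c k)]%N; exists k.
  rewrite sum_c -sum_nat_const leq_sum // => k' _.
  by rewrite /k; case: arg_maxnP => // k'' _; apply.
have mem_c i (ic : (i < size (c k))%N) : nth u0 (c k) i \in c k by exact: mem_nth.
exists (size (c k)), (fun i => nth u0 (c k) i); split=> //.
- move=> i j /eqP; rewrite nth_uniq ?ltn_ord //; first by move/eqP/val_inj.
  exact/filter_uniq/fset_uniq.
- move=> i; have := mem_c i (ltn_ord i); rewrite mem_filter => /andP[_].
  by rewrite in_fset_set // inE.
- move=> i j; have := mem_c i (ltn_ord i); have := mem_c j (ltn_ord j).
  by rewrite !mem_filter => /andP[/eqP -> _] /andP[/eqP -> _].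
Qed.

End FiniteCounting.

Section DivMod.
Variable m : nat.
Implicit Types (x y : 'rV[int]_m) (n : nat).

(** [rdiv] indexes the cube of side [n] that contains [x], and [rmod] is the position of [x] in that
    cube. *)
Definition rdiv n x : 'rV[int]_m := \row_k (x 0%R k %/ n)%Z.
Definition rmod n x : 'rV[int]_m := \row_k (x 0%R k %% n)%Z.

Lemma rdiv_eq n x : x = rmod n x + rdiv n x *+ n.
Proof.
apply/rowP => k; rewrite mxE mulmxnE !mxE {1}(divz_eq (x 0 k) n) addrC.
by rewrite -mulr_natr natz.
Qed.

Lemma rmod_ge0 n x k : (0 < n)%N -> 0 <= rmod n x 0 k.
Proof. by move=> n0; rewrite mxE modz_ge0 //; lia. Qed.

Lemma rmod_lt n x k : (0 < n)%N -> rmod n x 0 k < n%:Z.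
Proof. by move=> n0; rewrite mxE ltz_pmod //; lia. Qed.

Lemma rdivP n x c : (0 < n)%N ->
  (forall k, 0 <= (x - c *+ n) 0 k < n%:Z) -> rdiv n x = c.
Proof.
move=> n0 H; apply/rowP => k; have := H k; rewrite !mxE mulmxnE -mulr_natr natz.
move: (x 0 k) (c 0 k) => a b ab.
have -> : a = b * n%:Z + (a - b * n%:Z) by lia.
by rewrite divzMDl ?divz_small ?addr0 //; lia.
Qed.

Lemma rdivD n x c : (0 < n)%N -> rdiv n (x + c *+ n) = rdiv n x + c.
Proof.
move=> n0; apply: rdivP => // k.
by rewrite mulrnDl opprD addrACA subrr addr0 {1 3}(rdiv_eq n x) addrK rmod_ge0 ?rmod_lt.
Qed.

Lemma rmodD n x c : (0 < n)%N -> rmod n (x + c *+ n) = rmod n x.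
Proof.
move=> n0; have := rdiv_eq n (x + c *+ n); rewrite rdivD // mulrnDl addrA.
by move/addIr; rewrite {1}(rdiv_eq n x) => /addIr.
Qed.

End DivMod.

Section Keys.
Variables (m d : nat) (g : int -> tree d).
Hypothesis g_geodesic : two_sided_geodesic g.
Hypothesis g0 : g 0 = tree_root d.
Hypothesis g_periodic : periodic_geodesic g.
Variables (n : nat) (t : 'I_m -> int).
Hypothesis n0 : (0 < n)%N.
Hypothesis t_dvd : forall k, ((even_period g)%:Z %| t k)%Z.
Implicit Types (h : 'rV[int]_m -> tree d).

Lemma box_subproof (x : 'rV[int]_m) k : (`|rmod n x 0%R k| < n)%N.
Proof. by have := rmod_ge0 x k n0; have := rmod_lt x k n0; lia. Qed.

Definition box (x : 'rV[int]_m) : {ffun 'I_m -> 'I_n} :=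
  [ffun k => Ordinal (box_subproof x k)].
Definition vec (y : {ffun 'I_m -> 'I_n}) : 'rV[int]_m := \row_k (y k : nat)%:Z.

Lemma vec_box x : vec (box x) = rmod n x.
Proof. by apply/rowP => k; rewrite mxE ffunE /=; have := rmod_ge0 x k n0; lia. Qed.

(** With D the half of mn, the vertex [h 0] is within D of the point of [g] at height
    [ht g (h 0) - D], which is within 2D + 1 of the root. *)
Definition word_bound := (3 * (m * n)./2).+1.

Lemma frame_size h : frame g n t h -> (size (sval (h 0%R)) <= word_bound)%N.
Proof.
case=> _ _ hD _ h0; have := hD 0; rewrite /depth_le => e.
have := tree_dist_iter_up g_geodesic g0 (m * n)./2 (h 0); rewrite e tree_distC => le1.
have := tree_dist_trans (g (ht g (h 0) - (m * n)./2%:Z)) (g 0) (h 0).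
have := tree_dist_g g_geodesic g0 0 (ht g (h 0) - (m * n)./2%:Z).
by rewrite -tree_dist_root -g0 /word_bound; lia.
Qed.

Variable P : pred {ffun 'I_m -> 'I_n}.

(** The value at 0, letter by letter, and the colours of the edges starting at the points of one box
    selected by [P]; periodicity of colours supplies the other boxes. *)
Definition key h :
    {ffun 'I_word_bound -> option 'I_d} * {ffun {y | P y} * 'I_m -> option 'I_d} :=
  ([ffun i : 'I_word_bound => onth (sval (h 0)) i],
   [ffun p => colour (h (vec (val p.1))) (h (vec (val p.1) + zbasis p.2))]).

Variables h h' : 'rV[int]_m -> tree d.
Hypotheses (hf : frame g n t h) (hf' : frame g n t h') (hk : key h = key h').

Lemma key_root : h 0 = h' 0.
Proof.
have [/ffunP e _] := hk; apply: tree_inj; apply: eq_from_onth => i.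
have [ib|ib] := ltnP i word_bound; first by have := e (Ordinal ib); rewrite !ffunE.
by rewrite !onth_default //; apply: leq_trans ib; exact: frame_size.
Qed.

Lemma key_step x k : P (box x) -> (h x = h' x <-> h (x + zbasis k) = h' (x + zbasis k)).
Proof.
move=> Px; have colE f : frame g n t f ->
    colour (f x) (f (x + zbasis k)) = colour (f (rmod n x)) (f (rmod n x + zbasis k)).
  move=> ff; rewrite [in f x](rdiv_eq n x) [in f (x + _)](rdiv_eq n x) addrAC.
  rewrite !(frame_mulz g_geodesic g0 g_periodic _ _ t_dvd ff).
  by rewrite colour_equivariant //; exact: rmul_equivariant.
have col : colour (h x) (h (x + zbasis k)) = colour (h' x) (h' (x + zbasis k)).
  rewrite !colE // -vec_box; have [_ /ffunP e] := hk.
  by have := e (exist _ (box x) Px, k); rewrite !ffunE.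
have [hh _ _ _ _] := hf; have [hh' _ _ _ _] := hf'.
have [i ci hi] := colour_adj ((graph_hom_adj h).1 hh _ _ (zadj_basis x k)).
have [i' ci' hi'] := colour_adj ((graph_hom_adj h').1 hh' _ _ (zadj_basis x k)).
move: col; rewrite ci ci' => -[ii]; rewrite hi hi' ii; split=> [->//|e].
by rewrite -[h x](tree_actK i') e tree_actK.
Qed.

Lemma key_step_sub x k : P (box (x - zbasis k)) ->
  (h (x - zbasis k) = h' (x - zbasis k) <-> h x = h' x).
Proof. by move=> /(key_step k); rewrite subrK. Qed.

Lemma key_step_sgz x k (a : int) : a != 0 -> P (box x) -> P (box (x - zbasis k *~ sgz a)) ->
  h (x - zbasis k *~ sgz a) = h' (x - zbasis k *~ sgz a) -> h x = h' x.
Proof.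
case: sgzP => // _ _ Px; first by rewrite mulr1z => /key_step_sub ->.
by rewrite mulrN1z opprK => _ /(key_step k Px).
Qed.

End Keys.

Section Skeleton.
Variables (m d : nat) (g : int -> tree d).
Hypothesis g_geodesic : two_sided_geodesic g.
Hypothesis g0 : g 0 = tree_root d.
Hypothesis g_periodic : periodic_geodesic g.
Variables (n : nat) (t : 'I_m -> int).
Hypothesis n0 : (0 < n)%N.
Hypothesis t_dvd : forall k, ((even_period g)%:Z %| t k)%Z.
Implicit Types (h : 'rV[int]_m -> tree d).

(* The faces of the cubes of side [n]: configurations that agree there can be
   exchanged cube by cube. *)
Definition skeleton (x : 'rV[int]_m) := exists k, (n%:Z %| x 0%R k)%Z.

Definition skeleton_box : pred {ffun 'I_m -> 'I_n} := fun y => [exists k, y k == 0%N :> nat].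

Lemma skeleton_boxP x : skeleton x -> skeleton_box (box n0 x).
Proof.
by case=> k /dvdz_mod0P xk; apply/existsP; exists k; rewrite ffunE /= mxE xk.
Qed.

Lemma key_all_inj h h' : frame g n t h -> frame g n t h' ->
  @key m d n xpredT h = @key m d n xpredT h' -> h =1 h'.
Proof.
move=> hf hf' hk; apply: (@lattice_ind _ (fun x => h x = h' x) 0).

  exact: (key_root g_geodesic g0 n0 hf hf' hk).
have step := key_step (n0 := n0) g_geodesic g0 g_periodic t_dvd hf hf' hk.
move=> y z hy /zadj_basisP[k [->|e]]; first by apply: (proj1 (step y k isT)).
by apply: (proj2 (step z k isT)); rewrite -e.
Qed.

Hypothesis m2 : (2 <= m)%N.

Lemma other_index (j : 'I_m) : exists k, k != j.
Proof.
have : (0 < #|predC1 j|)%N by rewrite cardC1 card_ord; lia.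
by case/card_gt0P => k; exists k.
Qed.

(** Since m >= 2, every axis lies in the skeleton, because another coordinate vanishes there. A
    point whose coordinate [j] is divisible by [n] reaches the axis [j] by moves that keep this
    coordinate, hence within the skeleton. *)
Lemma key_skeleton h h' : frame g n t h -> frame g n t h' ->
  key skeleton_box h = key skeleton_box h' -> forall x, skeleton x -> h x = h' x.
Proof.
move=> hf hf' hk.
have step := key_step_sgz (n0 := n0) g_geodesic g0 g_periodic t_dvd hf hf' hk.
have basis_mulz (j i : 'I_m) (a : int) : (zbasis j *~ a) 0 i = (i == j)%:R * a.
  by rewrite -scaler_int mxE zbasisE mulrC intz.
have axis j (a : int) : h (zbasis j *~ a) = h' (zbasis j *~ a).
  have sk b : skeleton_box (box n0 (zbasis j *~ b)).
    have [k kj] := other_index j; apply: skeleton_boxP; exists k.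
    by rewrite basis_mulz (negbTE kj) mul0r dvdz0.
  move e : `|a|%N => l; elim: l a e => [|l IH] a al.
    have -> : a = 0 by lia.
    by rewrite mulr0z; exact: (key_root g_geodesic g0 n0 hf hf' hk).
  have a0 : a != 0 by lia.
  apply: (step _ j a a0); rewrite -?mulrzBr ?sk //.
  by apply: IH; case: sgzP a0; lia.
move=> x [j xj]; pose rest (y : 'rV[int]_m) := y - zbasis j *~ y 0 j.
have restE (y : 'rV[int]_m) k : rest y 0 k = if k == j then 0 else y 0 k.
  rewrite mxE [X in _ + X]mxE basis_mulz; case: eqVneq => [->|_]; first by rewrite mul1r subrr.
  by rewrite mul0r subr0.
move e : (nrm (rest x)) => l; elim: l x e xj => [|l IH] x e xj.
  by move/nrm_eq0/subr0_eq: e => ->.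
have [k xk] : exists k, rest x 0 k != 0.
  apply/existsP; apply: contra_eqT e => /existsPn H; rewrite /nrm big1 // => k _.
  by move: (H k); rewrite negbK => /eqP ->.
have kj : k != j by apply: contraNneq xk => ->; rewrite restE eqxx.
have := nrm_pull xk; rewrite restE (negbTE kj) e => -[el].
have xk0 : x 0 k != 0 by move: xk; rewrite restE (negbTE kj).
pose z := x - zbasis k *~ sgz (x 0 k).
have zj : z 0 j = x 0 j.
  by rewrite mxE [X in _ + X]mxE basis_mulz eq_sym (negbTE kj) mul0r subr0.
apply: (step _ k _ xk0); first by apply: skeleton_boxP; exists j.
  by apply: skeleton_boxP; exists j; rewrite -/z zj.
apply: IH; last by rewrite -/z zj.
rewrite -el; congr nrm; rewrite /rest -/z zj /z; exact: addrAC.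
Qed.

Lemma card_skeleton_box : (#|skeleton_box| <= m * n ^ m.-1)%N.
Proof.
pose C k := [pred y : {ffun 'I_m -> 'I_n} | y k == 0%N :> nat].
have cardC k : #|C k| = (n ^ m.-1)%N.
  pose F j : pred 'I_n := if j == k then [pred i : 'I_n | i == 0%N :> nat] else predT.
  have -> : #|C k| = #|(family F : simpl_pred {ffun 'I_m -> 'I_n})|.
    apply: eq_card => y; rewrite !inE; apply/idP/familyP => [yk j|/(_ k)].
      by rewrite /F; case: eqP => // ->.
    by rewrite /F eqxx.
  rewrite card_family foldrE big_map big_enum (bigD1 k) //=.
  have -> : #|F k| = 1%N.
    rewrite /F eqxx -(card1 (Ordinal n0)); apply: eq_card => i.
    by rewrite !inE; apply/eqP/eqP.
  rewrite mul1n (eq_bigr (fun=> n)) => [|j /negbTE jk]; last by rewrite /F jk cardT size_enum_ord.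
  by rewrite prod_nat_const cardC1 card_ord.
have : (#|skeleton_box| <= \sum_k #|C k|)%N.
  rewrite -sum1_card big_mkcond /=.
  under [leqRHS]eq_bigr do rewrite -sum1_card big_mkcond /=.
  rewrite exchange_big leq_sum //= => y _; case: ifP => // /existsP[k yk].
  by rewrite (bigD1 k) //= inE yk.
rewrite (eq_bigr (fun=> n ^ m.-1)%N) => [|k _]; last exact: cardC.
by rewrite sum_nat_const card_ord.
Qed.

End Skeleton.
Section Samples.
Variables (R : realType) (m d : nat) (g : int -> tree d).
Hypothesis g_geodesic : two_sided_geodesic g.
Hypothesis g0 : g 0 = tree_root d.
Hypothesis g_periodic : periodic_geodesic g.
Variables (n : nat) (s : 'rV[R]_m).
Hypothesis n0 : (0 < n)%N.
Implicit Types (h : 'rV[int]_m -> tree d).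
Local Notation t := (target n g s).

(** Recording the signs in the key ensures that one class yields frames by a common reflection, so
    that agreement on the skeleton survives it. *)
Definition signs h : {ffun 'I_m -> bool} :=
  xget [ffun=> false] [set e | frame g n t (h \o mirror e)].

Lemma signsP h : Hset n g s h -> frame g n t (h \o mirror (signs h)).
Proof.
move=> /(Hset_frame g_geodesic g0 g_periodic n0)[e he].
by rewrite /signs; case: xgetP => [//|/(_ e)].
Qed.

Lemma mirror_inj h h' e : h \o mirror e =1 h' \o mirror e -> h = h'.
Proof. by move=> e_hh; apply/funext => x; have := e_hh (mirror e x); rewrite /= mirrorK. Qed.

Lemma Hset_finite : finite_set (Hset n g s).
Proof.
apply: (finite_code (code := fun h => (signs h, @key m d n xpredT (h \o mirror (signs h))))).
move=> h h' /signsP hf /signsP hf' /[dup] /(congr1 fst) /= e /(congr1 snd) /= k.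
apply: (mirror_inj (e := signs h')); rewrite e in hf k.
by apply: (key_all_inj g_geodesic g0 g_periodic n0 _ hf hf' k); exact: dvdz_target.
Qed.

(* A configuration on the skeleton is determined by O(n^(m-1)) colours, so one of
   these classes is exponentially as large as [Hset]. *)
Lemma samples : (2 <= m)%N -> exists N (f : 'I_N -> 'rV[int]_m -> tree d),
  [/\ injective f, forall i, frame g n t (f i),
      forall i j x, skeleton n x -> f i x = f j x &
      (#|` fset_set (Hset n g s)| <= (2 * d.+1) ^ ((4 * m + m * m) * n ^ m.-1) * N)%N].
Proof.
move=> m2; pose K h := (signs h, key (@skeleton_box m n) (h \o mirror (signs h))).
have [N [f [fi fH fk cardf]]] := pigeonhole_class K Hset_finite.
have ff i : frame g n t (f i \o mirror (signs (f i))) by exact: signsP.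
exists N, (fun i => f i \o mirror (signs (f i))); split=> //.
- move=> i j e; apply: fi; have /(congr1 fst) /= es := fk i j; rewrite es in e.
  by apply: (mirror_inj (e := signs (f j))) => x; rewrite -[LHS]/((f i \o _) x) e.
- move=> i j x; apply: (key_skeleton g_geodesic g0 g_periodic n0 _ m2 (ff i) (ff j)).
    exact: dvdz_target.
  by have /(congr1 snd) := fk i j.
apply: leq_trans cardf _; rewrite leq_mul2r; apply/orP; right.
(* In units of n^(m-1), the exponents are at most m for the signs, 3m for the word at 0 and m^2 for
   the skeleton edges; the base 2(d+1) dominates both 2 and d+1. *)
rewrite !card_prod !card_ffun card_prod card_sig card_option card_bool !card_ord.
have le_sk := card_skeleton_box m n0.
rewrite -expnD; set W := word_bound m n.
have nm : (n <= n ^ m.-1)%N by rewrite -{1}[n]expn1 leq_pexp2l //; lia.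
have le1 : (2 ^ m <= (2 * d.+1) ^ m)%N by rewrite leq_exp2r; lia.
have le2 E : (d.+1 ^ E <= (2 * d.+1) ^ E)%N by case: E => // E; rewrite leq_exp2r; lia.
apply: leq_trans (leq_mul le1 (le2 _)) _; rewrite -expnD leq_pexp2l //.
have W3 : (W <= 3 * m * n ^ m.-1)%N.
  apply: (@leq_trans (3 * m * n)%N); last by rewrite leq_mul2l nm orbT.
  have : (2 <= m * n)%N by exact: leq_mul m2 n0.
  by rewrite /W /word_bound -mulnA; move: (m * n)%N => z; lia.
have H1 : (#|skeleton_box (m:=m) (n:=n)| * m <= m * m * n ^ m.-1)%N.
  by rewrite mulnC -mulnA leq_mul2l le_sk orbT.
have H2 : (m <= m * n ^ m.-1)%N by rewrite leq_pmulr // expn_gt0 n0.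
apply: leq_trans (leq_add H2 (leq_add W3 H1)) _.
by rewrite -!mulnDl leq_mul2r; apply/orP; right; lia.
Qed.

End Samples.

(** * Linear forms and extensions pinned on the period lattice *)

Section Dot.
Variable m : nat.
Implicit Types (t : 'I_m -> int) (c : 'rV[int]_m).

Definition dot t c : int := \sum_k t k * c 0 k.

Lemma dotD t c c' : dot t (c + c') = dot t c + dot t c'.
Proof. by rewrite /dot -big_split; apply: eq_bigr => k _; rewrite mxE mulrDr. Qed.

Lemma dotN t c : dot t (- c) = - dot t c.
Proof. by rewrite /dot -sumrN; apply: eq_bigr => k _; rewrite mxE mulrN. Qed.

Lemma dotB t c c' : dot t (c - c') = dot t c - dot t c'.
Proof. by rewrite dotD dotN. Qed.

Lemma dot0 t : dot t 0 = 0.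
Proof. by rewrite /dot big1 // => k _; rewrite mxE mulr0. Qed.

Lemma dot_dvd (q : int) t c : (forall k, (q %| t k)%Z) -> (q %| dot t c)%Z.
Proof. by move=> qt; apply: rpred_sum => k _; apply: dvdz_mulr. Qed.

Lemma dot_le (b : int) t c : (forall k, `|t k| <= b) -> `|dot t c| <= b * (nrm c)%:Z.
Proof.
move=> tb; rewrite /dot /nrm (big_morph Posz PoszD (erefl _)) mulr_sumr.
apply: le_trans (ler_norm_sum _ _ _) _; apply: ler_sum => k _.
by rewrite normrM abszE; apply: ler_wpM2r.
Qed.

Lemma nrm_mulrn c n : nrm (c *+ n) = (nrm c * n)%N.
Proof.
rewrite /nrm big_distrl; apply: eq_bigr => k _.
by rewrite mulmxnE -mulr_natr natz abszM.
Qed.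

Lemma zsum_mulrn c n : zsum (c *+ n) = zsum c *+ n.
Proof. by rewrite /zsum -sumrMnl; apply: eq_bigr => k _; rewrite mulmxnE. Qed.

Lemma nrm_rmod (x : 'rV[int]_m) n : (0 < n)%N -> (nrm (rmod n x) <= m * n)%N.
Proof.
move=> n0; rewrite /nrm -[m in leqRHS]card_ord -sum_nat_const leq_sum // => k _.
by have := rmod_ge0 x k n0; have := rmod_lt x k n0; lia.
Qed.

End Dot.

Section Glue.
Variables (m d : nat) (g : int -> tree d).
Hypothesis g_geodesic : two_sided_geodesic g.
Hypothesis g0 : g 0 = tree_root d.
Hypothesis g_periodic : periodic_geodesic g.
Local Notation q := (even_period g).
Variables (N : nat) (T : 'I_m -> int).
Hypotheses (N0 : (0 < N)%N) (N_even : ~~ odd N).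
Hypothesis T_dvd : forall k, (q%:Z %| T k)%Z.
Hypothesis T_le : forall k, `|T k| <= N%:Z.
Variables (A : set 'rV[int]_m) (val : 'rV[int]_m -> tree d).
Hypothesis A_shift : forall x c, A x -> A (x + c *+ N).
Hypothesis val_shift : forall x c, A x -> val (x + c *+ N) = gshift g (dot T c) (val x).
Hypothesis A_compat : forall x y, A x -> A y -> compat g (nrm (x - y)) (val x) (val y).
Hypothesis A_compat0 : forall x, A x -> compat g (nrm x) (val x) (g 0).
Hypothesis A_parity : forall x, A x -> (2 %| ht g (val x) - zsum x)%Z.
Hypothesis A_depth : forall x, A x -> depth_le g (m * N)./2 (val x).

Let gshiftqP c : (q%:Z %| c)%Z -> shifts g (gshift g c) c.
Proof. exact: (gshiftP g_geodesic g0 (even_periodP g_periodic).1). Qed.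

Let T_shifts c : shifts g (gshift g (dot T c)) (dot T c).
Proof. exact/gshiftqP/dot_dvd. Qed.

Lemma compatC l w w' : compat g l w w' -> compat g l w' w.
Proof.
move=> [c1 c2]; split=> [|k k' kk e]; first by lia.
by rewrite (c2 k' k) //; lia.
Qed.

(* The lattice [N Z^m] is pinned to [g], which fixes the slope and the value
   at 0. *)
Lemma pinned_extension : exists H, [/\ frame g N T H, H 0 = g 0 & forall x, A x -> H x = val x].
Proof.
pose pinned (x : 'rV[int]_m) := x = rdiv N x *+ N.
pose A' := A `|` pinned.
pose val' x := if `[< pinned x >] then g (dot T (rdiv N x)) else val x.
have pinnedD x c : pinned x -> pinned (x + c *+ N).
  by rewrite /pinned rdivD // mulrnDl => <-.
have A'D x c : A' (x + c *+ N) <-> A' x.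
  have D y c' : A' y -> A' (y + c' *+ N).
    by case=> [/A_shift|/pinnedD] /(_ c'); [left|right].
  by split=> [/(D _ (- c))|/D //]; rewrite mulNrn addrK.
have compat0 x c : A x -> compat g (nrm (x - c *+ N)) (val x) (g (dot T c)).
  move=> Ax; have := A_compat0 (A_shift (- c) Ax); rewrite mulNrn.
  move=> /(shifts_compat g_geodesic g0 (T_shifts c)).
  rewrite -mulNrn val_shift // (proj2 (T_shifts c)) add0r.
  rewrite -(gshiftD g_geodesic g0 (even_periodP g_periodic).1) ?dot_dvd //.
  by rewrite dotN subrr (gshift0 g_geodesic g0 (even_periodP g_periodic).1).
have compat_g c c' : compat g (nrm (c *+ N - c' *+ N)) (g (dot T c)) (g (dot T c')).
  apply: (compat_depth g_geodesic g0 (D := 0)); [exact: depth_le_g|exact: depth_le_g|].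
  rewrite !ht_g // mulr0 addr0 -mulrnBl nrm_mulrn PoszM -dotB mulrC.
  exact: dot_le.
have val'P x : A' x -> (pinned x /\ val' x = g (dot T (rdiv N x))) \/
    (A x /\ val' x = val x).
  by rewrite /val' /A'; case: asboolP => [px _|np [Ax|//]]; [left|right].
(* Where the pinned lattice meets [A], compatibility at distance 0, with no level climbed, shows
   that the two prescriptions agree. *)
have val'A x : A x -> val' x = val x.
  rewrite /val'; case: asboolP => // px Ax; have := compat0 x (rdiv N x) Ax.
  by rewrite -px subrr nrm0 => -[c1 /(_ 0%N 0%N)] /= -> //; lia.
have rdiv0 : rdiv N 0 = 0 :> 'rV[int]_m.
  by apply: rdivP => // k; rewrite mul0rn subrr mxE; lia.
have pinned0 : pinned 0 by rewrite /pinned rdiv0 mul0rn.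
have A'0 : A' 0 by right.
have compat' x y : A' x -> A' y -> compat g (nrm (x - y)) (val' x) (val' y).
  move=> /val'P[[px ->]|[Ax ->]] /val'P[[py ->]|[Ay ->]].
  - by rewrite {1}px {1}py; exact: compat_g.
  - by rewrite nrmB; apply: compatC; rewrite {1}px; exact: compat0.
  - by rewrite {1}py; exact: compat0.
  - exact: A_compat.
have parity' x : A' x -> (2 %| ht g (val' x) - zsum x)%Z.
  move=> /val'P[[px ->]|[Ax ->]]; last exact: A_parity.
  rewrite ht_g // {2}px zsum_mulrn -[zsum _ *+ N]mulr_natr natz.
  have := dvdz_even_period g_periodic (dot_dvd (rdiv N x) T_dvd).
  have N2 : (2 %| N%:Z)%Z by lia.
  by move=> ?; apply: rpredB => //; apply: dvdz_mull.
pose H := ext g A' val' 0; have HA' x : A' x -> H x = val' x by exact: (ext_on 0 compat').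
have depth' x : A' x -> depth_le g (m * N)./2 (val' x).
  by move=> /val'P[[_ ->]|[/A_depth ? ->]] //; exact: depth_le_g.
have H0 : H 0 = g 0.
  by rewrite HA' // /val'; case: asboolP => // _; rewrite rdiv0 dot0.
exists H; split=> //; last by move=> x Ax; rewrite HA' ?val'A //; left.
split; rewrite ?H0 ?ht_g //.
- exact: (ext_hom g_geodesic g0 A'0 compat' parity').
- move=> x k; apply: (ext_shift g_geodesic g0 A'0 compat' (gshiftqP (T_dvd k))) => y.
    exact: A'D.
  have Tk : T k = dot T (zbasis k).
    rewrite /dot (bigD1 k) //= big1 => [|j /negbTE jk]; rewrite zbasisE ?jk ?mulr0 //.
    by rewrite eqxx mulr1 addr0.
  move=> A'y; have [[py ->]|[Ay ->]] := val'P _ A'y; last by rewrite val'A ?val_shift ?Tk //; exact: A_shift.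
  rewrite (proj2 (gshiftqP (T_dvd k))) /val'; case: asboolP => [_|[]]; last exact: pinnedD.
  by rewrite rdivD // dotD Tk.
- by move=> x; exact: (ext_depth g_geodesic g0 A'0 compat').
Qed.

End Glue.

(** * Laminates *)

Section Zigzag.
Variables L B : nat.
Hypothesis L0 : (0 < L)%N.
Implicit Types p : int.

(* A function with slope 1 where it is rising and 0 elsewhere, on alternate
   intervals of length [L]. *)
Definition rising p : bool := ((p %% (2 * L)%N)%Z < L%:Z)%R.
Definition zigzag p : int :=
  (p %/ (2 * L)%N)%Z * L%:Z + Order.min (p %% (2 * L)%N)%Z L%:Z.
Definition kink_free p : bool :=
  ((B%:Z <= (p %% L)%Z) && ((p %% L)%Z < L%:Z - B%:Z))%R.

Lemma divz2L p : p = (p %/ (2 * L)%N)%Z * (2 * L%:Z) + (p %% (2 * L)%N)%Z.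
Proof. by rewrite {1}(divz_eq p (2 * L)%N) PoszM. Qed.

Lemma modz2L p : 0 <= (p %% (2 * L)%N)%Z < 2 * L%:Z.
Proof.
have := @modz_ge0 p (2 * L)%N; have := @ltz_pmod p (2 * L)%N.
by rewrite -PoszM; lia.
Qed.

Lemma zigzag_lip p p' : p' <= p -> 0 <= zigzag p - zigzag p' <= p - p'.
Proof.
rewrite /zigzag; have := modz2L p; have := modz2L p'.
have := divz2L p; have := divz2L p'.
move: (p %/ _)%Z (p %% _)%Z (p' %/ _)%Z (p' %% _)%Z => j r j' r' -> -> r'b rb le_p.
have [jj|jj] : j = j' \/ j' + 1 <= j by nia.
  by rewrite jj in le_p *; lia.
have : 0 <= (j - j' - 1) * L%:Z by apply: mulr_ge0; lia.
by lia.
Qed.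

(** This is what makes the mean slope of the laminate the average of the two slopes, up to a bounded
    error. *)
Lemma zigzag_half p : 0 <= 2 * zigzag p - p <= L%:Z.
Proof.
rewrite /zigzag; have := modz2L p; have := divz2L p.
move: (p %/ _)%Z (p %% _)%Z => j r ->; lia.
Qed.

Lemma zigzag_rising p : rising p -> zigzag p = p - (p %/ (2 * L)%N)%Z * L%:Z.
Proof.
rewrite /rising /zigzag; have := modz2L p; have := divz2L p.
move: (p %/ _)%Z (p %% _)%Z => j r ->; lia.
Qed.

Lemma zigzag_falling p : ~~ rising p -> zigzag p = ((p %/ (2 * L)%N)%Z + 1) * L%:Z.
Proof.
rewrite /rising /zigzag; have := modz2L p.
move: (p %/ _)%Z (p %% _)%Z => j r; lia.
Qed.

Lemma zigzag_dvd (q : int) p : (q %| p)%Z -> (q %| L%:Z)%Z -> (q %| zigzag p)%Z.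
Proof.
move=> qp qL; case: (boolP (rising p)) => [/zigzag_rising|/zigzag_falling] ->.
  by apply: rpredB => //; apply: dvdz_mull.
exact: dvdz_mull.
Qed.

Lemma modzL p : (p %% L)%Z =
  if rising p then (p %% (2 * L)%N)%Z else (p %% (2 * L)%N)%Z - L%:Z.
Proof.
rewrite /rising; have := modz2L p; have := divz2L p.
move: (p %/ _)%Z (p %% _)%Z => j r -> rb; case: ifP => rL.
  by rewrite mulrA modzMDl modz_small //; lia.
have -> : j * (2 * L%:Z) + r = (2 * j + 1) * L%:Z + (r - L%:Z) by lia.
by rewrite modzMDl modz_small //; lia.
Qed.

(** Two points on different linear pieces have a kink between them and keep a margin [B] on either
    side of it. *)
Lemma kink_free_sep p p' : kink_free p -> kink_free p' ->
  ((p %/ (2 * L)%N)%Z = (p' %/ (2 * L)%N)%Z /\ rising p = rising p') \/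
  2 * B%:Z <= `|p - p'|.
Proof.
rewrite /kink_free !modzL /rising.
have := modz2L p; have := modz2L p'; have := divz2L p; have := divz2L p'.
move: (p %/ _)%Z (p %% _)%Z (p' %/ _)%Z (p' %% _)%Z => j r j' r' -> -> r'b rb.
have [->|[jj|jj]] : j = j' \/ j' + 1 <= j \/ j + 1 <= j' by lia.
- by case: ifP; case: ifP; lia.
- have : 0 <= (j - j' - 1) * L%:Z by apply: mulr_ge0; lia.
  by case: ifP; case: ifP; lia.
- have : 0 <= (j' - j - 1) * L%:Z by apply: mulr_ge0; lia.
  by case: ifP; case: ifP; lia.
Qed.

Lemma rising_shift p : rising (p + L%:Z) = ~~ rising p.
Proof.
rewrite /rising; have := modz2L p; have := divz2L p.
move: (p %/ _)%Z (p %% _)%Z => j r -> rb; have [rL|rL] := ltP r L%:Z.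
  rewrite -addrA (_ : 2 * L%:Z = (2 * L)%N) ?PoszM // modzMDl modz_small ?PoszM; lia.
have -> : j * (2 * L%:Z) + r + L%:Z = (j + 1) * (2 * L)%N%:Z + (r - L%:Z) by rewrite PoszM; lia.
by rewrite modzMDl modz_small ?PoszM; lia.
Qed.

Lemma kink_free_shift p : kink_free (p + L%:Z) = kink_free p.
Proof. by rewrite /kink_free modzDr. Qed.

Lemma small_multiple (x y : int) : `|x * y| < y -> x = 0.
Proof.
have [x0|[x0|//]] : x <= -1 \/ 1 <= x \/ x = 0 by lia.
  by have : y <= - x * y \/ y < 0; nia.
by have : y <= x * y \/ y < 0; nia.
Qed.

(** The forbidden window around the kinks has width 2B and recurs with period L = 2BJ, while the J
    translates are 2B apart: at most one of them falls into it. *)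
Lemma kink_free_translate J p : L = (2 * B * J)%N ->
  (#|[pred i : 'I_J | ~~ kink_free (p + (2 * B * i)%N%:Z)]| <= 1)%N.
Proof.
move=> LJ; apply/card_le1_eqP => i i'; rewrite !inE.
have near_kink (k : 'I_J) : ~~ kink_free (p + (2 * B * k)%N%:Z) ->
    exists a v : int, p + (2 * B * k)%N%:Z = a * L%:Z + v /\ - B%:Z <= v < B%:Z.
  rewrite /kink_free; have := divz_eq (p + (2 * B * k)%N%:Z) L.
  have := @modz_ge0 (p + (2 * B * k)%N%:Z) L; have := @ltz_pmod (p + (2 * B * k)%N%:Z) L.
  move: (_ %/ _)%Z (_ %% _)%Z => a u ub u0 e k_kink.
  have [uB|uB] := ltP u B%:Z; first by exists a, u; split; [exact: e|lia].
  by exists (a + 1), (u - L%:Z); split; [rewrite e|]; lia.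
move=> /near_kink[a [v [e vb]]] /near_kink[a' [v' [e' vb']]].
have ie : ((i : nat)%:Z - (i' : nat)%:Z - (a - a') * J%:Z) * (2 * B%:Z) = v - v'.
  by move: e e'; rewrite LJ; lia.
have /small_multiple i0 : `|((i : nat)%:Z - (i' : nat)%:Z - (a - a') * J%:Z) * (2 * B%:Z)| < 2 * B%:Z.
  by rewrite ie; lia.
have /small_multiple a0 : `|(a - a') * J%:Z| < J%:Z.
  by have := ltn_ord i; have := ltn_ord i'; lia.
by apply: val_inj => /=; move: i0; rewrite a0; lia.
Qed.

End Zigzag.

(** * Exchanging samples cube by cube *)

Section Mixing.
Variables (m d : nat) (g : int -> tree d).
Hypothesis g_geodesic : two_sided_geodesic g.
Hypothesis g0 : g 0 = tree_root d.
Hypothesis g_periodic : periodic_geodesic g.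
Variables (n : nat) (t : 'I_m -> int).
Hypotheses (n0 : (0 < n)%N) (t_dvd : forall k, ((even_period g)%:Z %| t k)%Z).

(** A step in a positive direction that changes cube lands on the lower face of the next one. Hence
    samples that agree on the skeleton can be chosen independently in each cube. *)
Lemma rdivD_basis (x : 'rV[int]_m) k :
  rdiv n (x + zbasis k) = rdiv n x \/ skeleton n (x + zbasis k).
Proof.
have [dv|ndv] := boolP (n%:Z %| (x + zbasis k) 0%R k)%Z; first by right; exists k.
left; apply: rdivP => // j; have := rmod_ge0 x j n0; have := rmod_lt x j n0.
have xE i : x 0 i = rmod n x 0 i + (rdiv n x *+ n) 0 i by rewrite {1}(rdiv_eq n x) mxE.
have subE : (x + zbasis k - rdiv n x *+ n) 0 j = rmod n x 0 j + (j == k)%:R.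
  by rewrite mxE [X in _ + X]mxE [X in X - _]mxE zbasisE (xE j); ring.
rewrite subE; case: eqVneq => [jk|_]; last by rewrite addr0; lia.
suff : rmod n x 0 j + 1 != n%:Z by rewrite mulr1n; lia.
apply: contra ndv => /eqP e; rewrite -jk mxE zbasisE jk eqxx -jk (xE j) addrAC e.
rewrite mulmxnE -mulr_natr natz.
by apply: rpredD; [exact: dvdzz | exact: dvdz_mull].
Qed.

Lemma mix_hom K (f : 'I_K -> 'rV[int]_m -> tree d) (idx : 'rV[int]_m -> 'I_K) :
  (forall i, graph_hom (f i)) -> (forall i j x, skeleton n x -> f i x = f j x) ->
  graph_hom (fun x => f (idx (rdiv n x)) x).
Proof.
move=> fh fs; have step x k : adj (f (idx (rdiv n x)) x)
    (f (idx (rdiv n (x + zbasis k))) (x + zbasis k)).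
  have /(graph_hom_adj _).1/(_ _ _ (zadj_basis x k)) := fh (idx (rdiv n x)).
  by case: (rdivD_basis x k) => [-> //|sk]; rewrite (fs _ (idx (rdiv n (x + zbasis k))) _ sk).
apply/graph_hom_adj => x y /zadj_basisP[k [->|->]]; first exact: step.
exact/adjC/step.
Qed.

Lemma frame_rmod f x : frame g n t f ->
  f x = gshift g (dot t (rdiv n x)) (f (rmod n x)).
Proof.
by move=> ff; rewrite {1}(rdiv_eq n x) (frame_mulz g_geodesic g0 g_periodic _ _ t_dvd ff).
Qed.

Lemma frame_parity f x : frame g n t f -> (2 %| ht g (f x) - zsum x)%Z.
Proof.
case=> /graph_hom_adj fh _ _ f0 _.
apply: (@lattice_ind _ (fun x => (2 %| ht g (f x) - zsum x)%Z) 0); first by rewrite zsum0 subr0.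
move=> y z py yz; have := adj_ht g_geodesic g0 (fh _ _ yz).
have := nrm_zsum (y - z); have /zadj_nrm -> := yz; rewrite zsumB; move: py; lia.
Qed.

(** One mn bounds the distance from 0 inside a cube, the other the height at 0, as mn/2 + 1 <= mn
    when mn >= 2. *)
Lemma frame_ht f x : (2 <= m)%N -> frame g n t f ->
  `|ht g (f (rmod n x))| <= (2 * (m * n))%N%:Z.
Proof.
move=> m2 [fh _ _ _ f0]; have := graph_hom_dist 0 (rmod n x) fh.
have := tree_dist_ht g_geodesic g0 (f 0) (f (rmod n x)).
have := nrm_rmod x n0; rewrite subr0; have : (2 <= m * n)%N by exact: leq_mul m2 n0.
by move: f0; move: (m * n)%N (nrm _) (tree_dist _ _) => u v w; lia.
Qed.

Lemma nrm_rdivB (x y : 'rV[int]_m) :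
  (n * nrm (rdiv n x - rdiv n y) <= nrm (x - y) + m * n)%N.
Proof.
have e : (rdiv n x - rdiv n y) *+ n = (x - y) + (rmod n y - rmod n x).
  have E (u v a b : 'rV[int]_m) : u - v = (a + u - (b + v)) + (b - a).
    by apply/rowP => k; rewrite !mxE; ring.
  by rewrite mulrnBl [LHS](E _ _ (rmod n x) (rmod n y)) -!rdiv_eq.
rewrite mulnC -nrm_mulrn e; apply: leq_trans (nrmD _ _) _; rewrite leq_add2l.
rewrite /nrm -[m in leqRHS]card_ord -sum_nat_const leq_sum // => k _.
rewrite mxE [X in _ + X]mxE.
have := rmod_ge0 x k n0; have := rmod_lt x k n0.
have := rmod_ge0 y k n0; have := rmod_lt y k n0.
by move: (rmod n x 0 k) (rmod n y 0 k) => u v; lia.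
Qed.

End Mixing.

Section Laminate.
Variables (m d : nat) (g : int -> tree d).
Hypothesis g_geodesic : two_sided_geodesic g.
Hypothesis g0 : g 0 = tree_root d.
Hypothesis g_periodic : periodic_geodesic g.
Hypothesis m2 : (2 <= m)%N.
Local Notation q := (even_period g).
Variables (n : nat) (t1 t2 : 'I_m -> int).
Hypotheses (n0 : (0 < n)%N) (n_even : ~~ odd n).
Hypotheses (t1_dvd : forall k, (q%:Z %| t1 k)%Z) (t2_dvd : forall k, (q%:Z %| t2 k)%Z).
Variables (K1 K2 : nat).
Variables (f1 : 'I_K1 -> 'rV[int]_m -> tree d) (f2 : 'I_K2 -> 'rV[int]_m -> tree d).
Hypotheses (f1_inj : injective f1) (f2_inj : injective f2).
Hypotheses (f1_frame : forall i, frame g n t1 (f1 i))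
           (f2_frame : forall i, frame g n t2 (f2 i)).
Hypotheses (f1_skel : forall i j x, skeleton n x -> f1 i x = f1 j x)
           (f2_skel : forall i j x, skeleton n x -> f2 i x = f2 j x).
(* Cubes have side [n] and cells are cubes of [M] cubes, [mu] of which on each
   side are left empty; the kinks of the profile are [L] apart in height, and
   cubes at height less than [n b] from a kink are left empty. The slack [e] in
   the Lipschitz bounds absorbs the errors across these gaps. *)
Variables (b e L mu M1 : nat) (T : 'I_m -> int).
Local Notation B := (n * b)%N.
Local Notation M := (M1 + 2 * mu)%N.
Local Notation N := (n * M)%N.
Hypotheses (L0 : (0 < L)%N) (L_dvd : (q%:Z %| L%:Z)%Z).
Hypotheses (t1_le : forall k, `|t1 k| + e%:Z <= n%:Z)
           (t2_le : forall k, `|t2 k| + e%:Z <= n%:Z).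
Hypothesis T_dvd : forall k, (q%:Z %| T k)%Z.
Hypothesis eb : (6 * (m * n) <= e * b)%N.
Hypothesis T_close : forall k, `|2 * T k - M%:Z * (t1 k + t2 k)| <= (e * mu)%N%:Z.
Hypothesis e_mu : (4 * L + 12 * (m * n) <= e * mu)%N.

Implicit Types (x c z : 'rV[int]_m).

Let e0 : (0 < e)%N. Proof. by case: (e) eb => //; nia. Qed.
Let mu0 : (0 < mu)%N. Proof. by case: (mu) e_mu => //; nia. Qed.
Let M0 : (0 < M)%N. Proof. by lia. Qed.
Let N0 : (0 < N)%N. Proof. by rewrite muln_gt0 n0 M0. Qed.

Let gshiftqP (c : int) : (q%:Z %| c)%Z -> shifts g (gshift g c) c.
Proof. exact: (gshiftP g_geodesic g0 (even_periodP g_periodic).1). Qed.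

Let gshiftqD (c c' : int) w : (q%:Z %| c)%Z -> (q%:Z %| c')%Z ->
  gshift g (c + c') w = gshift g c (gshift g c' w).
Proof. exact: (gshiftD g_geodesic g0 (even_periodP g_periodic).1). Qed.

Variable theta : int.
Hypotheses (theta_ge0 : 0 <= theta) (theta_le : theta <= 3 * L%:Z).
Hypothesis theta_dvd : (q%:Z %| theta)%Z.

(** The difference of the two affine profiles, so that the kinks lie on parallel hyperplanes;
    [theta] moves them. *)
Definition phase c : int := dot (fun k => t1 k - t2 k) c + theta.

Lemma dot_diff c : dot (fun k => t1 k - t2 k) c = dot t1 c - dot t2 c.
Proof. by rewrite /dot -sumrB; apply: eq_bigr => k _; rewrite mulrBl. Qed.

(* The macroscopic profile on the cubes of a cell of side [M]: it has slope
   [t1] where the zigzag rises and [t2] elsewhere. *)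
Definition profile c : int := dot t2 c + zigzag L (phase c).

Definition good c : Prop :=
  (forall k, mu%:Z <= c 0 k < M1%:Z + mu%:Z) /\ kink_free L B (phase c).

(** The increment of the profile lies between those of the two affine functions, each of which is
    Lipschitz with constant n - e. *)
Lemma profile_lip c c' :
  `|profile c - profile c'| + e%:Z * (nrm (c - c'))%:Z <= n%:Z * (nrm (c - c'))%:Z.
Proof.
wlog le_p : c c' / phase c' <= phase c => [H|].
  have [/H//|/ltW/H] := leP (phase c') (phase c).
  by rewrite (nrmB c') distrC.
have := zigzag_lip L0 le_p; rewrite /profile.
have d1 : `|dot t1 (c - c')| <= (n%:Z - e%:Z) * (nrm (c - c'))%:Z.
  by apply: dot_le => k; have := t1_le k; lia.
have d2 : `|dot t2 (c - c')| <= (n%:Z - e%:Z) * (nrm (c - c'))%:Z.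
  by apply: dot_le => k; have := t2_le k; lia.
move: d1 d2; rewrite !dotB /phase !dot_diff; lia.
Qed.

(** One [L] is the oscillation of the zigzag, and 3L bounds the phase offset [theta]. *)
Lemma profile_affine c :
  0 <= 2 * profile c - (dot t1 c + dot t2 c) <= 4 * L%:Z.
Proof.
have := zigzag_half L0 (phase c); rewrite /profile /phase dot_diff; lia.
Qed.

Lemma profile_dvd c : (q%:Z %| profile c)%Z.
Proof.
apply: rpredD; first exact: dot_dvd.
apply: zigzag_dvd => //; apply: rpredD => //; apply: dot_dvd => k; exact: rpredB.
Qed.

(* The profile extended to all cubes of the lattice, with a jump at the
   boundary of each cell. *)
Definition lattice_profile c : int := dot T (rdiv M c) + profile (rmod M c).

Lemma lattice_profile_dvd c : (q%:Z %| lattice_profile c)%Z.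
Proof. by apply: rpredD; [exact: dot_dvd|exact: profile_dvd]. Qed.

Lemma lattice_profile_affine c (z := rdiv M c) :
  0 <= 2 * lattice_profile c - (dot t1 c + dot t2 c)
       - dot (fun k => 2 * T k - M%:Z * (t1 k + t2 k)) z <= 4 * L%:Z.
Proof.
have := profile_affine (rmod M c); rewrite /lattice_profile -/z.
have -> : dot (fun k => 2 * T k - M%:Z * (t1 k + t2 k)) z =
    2 * dot T z - M%:Z * (dot t1 z + dot t2 z).
  rewrite /dot -big_split !mulr_sumr -sumrB; apply: eq_bigr => k _ /=; lia.
have dM t : dot t c = dot t (rmod M c) + M%:Z * dot t z.
  rewrite {1}(rdiv_eq M c) dotD; congr (_ + _).
  by rewrite /dot mulr_sumr; apply: eq_bigr => k _; rewrite mulmxnE -mulr_natr natz mulrA mulrC.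
rewrite !dM; lia.
Qed.

(* Distinct cells are separated by a layer of width [mu]. *)
Lemma cell_sep c c' : good (rmod M c) -> (good (rmod M c') \/ c' = 0) ->
  rdiv M c <> rdiv M c' \/ c' = 0 ->
  (mu * nrm (rdiv M c - rdiv M c') <= nrm (c - c'))%N /\ (mu <= nrm (c - c'))%N.
Proof.
move=> [gc _] gc' zz'.
have c0 : rdiv M (0 : 'rV[int]_m) = 0.
  by apply: rdivP => // k; rewrite mul0rn subrr mxE; lia.
have entry (x : 'rV[int]_m) k : x 0 k = rmod M x 0 k + M%:Z * rdiv M x 0 k.
  by rewrite {1}(rdiv_eq M x) mxE mulmxnE -mulr_natr natz mulrC.
have gc'k k : rmod M c' 0 k = 0 \/ mu%:Z <= rmod M c' 0 k < M1%:Z + mu%:Z.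
  case: gc' => [[/(_ k)]|->]; first by right.
  by left; rewrite mxE mxE mod0z.
have dist_k k : mu%:Z * `|(rdiv M c - rdiv M c') 0 k| <= `|(c - c') 0 k|.
  have subE (x y : 'rV[int]_m) : (x - y) 0 k = x 0 k - y 0 k by rewrite !mxE.
  rewrite !subE (entry c) (entry c'); have := gc k; have := gc'k k.
  move: (rmod M c 0 k) (rmod M c' 0 k) (rdiv M c 0 k) (rdiv M c' 0 k) => r r' z z' r'b rb.
  have [->|zz] := eqVneq z z'; first by rewrite subrr; lia.
  have le1 : M%:Z * `|z - z'| = `|M%:Z * z - M%:Z * z'| by rewrite -mulrBr normrM; lia.
  (* Positions inside cells differ by less than M - mu, so a difference of cell indices leaves at
     least mu times that difference. *)
  have le2 : M%:Z - mu%:Z <= (M%:Z - mu%:Z) * `|z - z'| by rewrite ler_peMr; lia.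
  by move: le2; rewrite mulrBl le1; lia.
have le_nrm : (mu * nrm (rdiv M c - rdiv M c') <= nrm (c - c'))%N.
  by rewrite /nrm big_distrr leq_sum // => k _; rewrite -lez_nat PoszM !abszE; exact: dist_k.
split=> //; case: zz' => [ne|c'0].
  have : nrm (rdiv M c - rdiv M c') <> 0%N by move/nrm_eq0/subr0_eq.
  by move: le_nrm; move: (nrm _) (nrm _) => u v; nia.
have k0 : 'I_m by exists 0%N; lia.
have : (absz ((c - c')%R 0%R k0) <= nrm (c - c'))%N by rewrite /nrm (bigD1 k0) //= leq_addr.
rewrite c'0 subr0 (entry c); have := gc k0.
move: (rmod M c 0 k0) (rdiv M c 0 k0) => r z rb.
have [z0|z0] := leP 0 z.
  have : 0 <= M%:Z * z by apply: mulr_ge0.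
  by lia.
have : M%:Z * z <= M%:Z * -1 by apply: ler_wpM2l; lia.
by lia.
Qed.

(** In the doubled inequality the two Lipschitz bounds leave a slack of 2e per unit of distance. One
    e pays for [T_close], since [mu] times the cell distance is at most the distance; the other e
    pays for 4L + 12mn, by [e_mu]. *)
Lemma lattice_profile_sep c c' (X : int) : (mu * nrm (rdiv M c - rdiv M c') <= nrm (c - c'))%N ->
  (mu <= nrm (c - c'))%N ->
  0 <= 2 * X - (dot t1 c' + dot t2 c')
       - dot (fun k => 2 * T k - M%:Z * (t1 k + t2 k)) (rdiv M c') <= 4 * L%:Z ->
  `|lattice_profile c - X| + (6 * (m * n))%N%:Z <= n%:Z * (nrm (c - c'))%:Z.
Proof.
move=> sep1 sep2 X_affine; have lattice_profile_c := lattice_profile_affine c.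
have d1 : `|dot t1 (c - c')| <= (n%:Z - e%:Z) * (nrm (c - c'))%:Z.
  by apply: dot_le => k; have := t1_le k; lia.
have d2 : `|dot t2 (c - c')| <= (n%:Z - e%:Z) * (nrm (c - c'))%:Z.
  by apply: dot_le => k; have := t2_le k; lia.
have dE := dot_le (rdiv M c - rdiv M c') T_close.
have e1 : (e * mu * nrm (rdiv M c - rdiv M c') <= e * nrm (c - c'))%N.
  by rewrite -mulnA leq_mul2l sep1 orbT.
have e2 : (e * mu <= e * nrm (c - c'))%N by rewrite leq_mul2l sep2 orbT.
rewrite !dotB in d1 d2 dE.
by lia.
Qed.

Variable a : 'rV[int]_m -> 'I_K1 * 'I_K2.

Definition cell x := rmod M (rdiv n x).
(** The assignment [a] gives every cube an index of each slope; the phase decides which one is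
    used. *)
Definition sample c := if rising L (phase c) then f1 (a c).1 else f2 (a c).2.
Definition laminate x := gshift g (lattice_profile (rdiv n x)) (sample (cell x) (rmod n x)).

Lemma laminate_rising x : rising L (phase (cell x)) -> laminate x =
  gshift g (lattice_profile (rdiv n x) - dot t1 (rdiv n x)) (f1 (a (rmod M (rdiv n x))).1 x).
Proof.
move=> r; rewrite /laminate /sample r (frame_rmod g_geodesic g0 g_periodic t1_dvd x (f1_frame _)).
by rewrite -gshiftqD ?subrK //; [apply: rpredB; [exact: lattice_profile_dvd|]|]; exact: dot_dvd.
Qed.

Lemma laminate_falling x : ~~ rising L (phase (cell x)) -> laminate x =
  gshift g (lattice_profile (rdiv n x) - dot t2 (rdiv n x)) (f2 (a (rmod M (rdiv n x))).2 x).
Proof.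
move=> /negbTE r; rewrite /laminate /sample r.
rewrite (frame_rmod g_geodesic g0 g_periodic t2_dvd x (f2_frame _)).
by rewrite -gshiftqD ?subrK //; [apply: rpredB; [exact: lattice_profile_dvd|]|]; exact: dot_dvd.
Qed.

Lemma sample_ht x : `|ht g (sample (cell x) (rmod n x))| <= (2 * (m * n))%N%:Z.
Proof. by rewrite /sample; case: ifP => _; exact: frame_ht. Qed.

Lemma laminate_ht x : `|ht g (laminate x) - lattice_profile (rdiv n x)| <= (2 * (m * n))%N%:Z.
Proof.
rewrite (shifts_ht g_geodesic g0 _ (gshiftqP (lattice_profile_dvd _))).
by have := sample_ht x; rewrite addrK.
Qed.

Lemma laminate_depth x : depth_le g (m * n)./2 (laminate x).
Proof.
apply: (shifts_depth g_geodesic g0 (gshiftqP (lattice_profile_dvd _))).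
by rewrite /sample; case: ifP => _; [case: (f1_frame (a (cell x)).1)|case: (f2_frame (a (cell x)).2)].
Qed.

Lemma laminate_parity x : (2 %| ht g (laminate x) - zsum x)%Z.
Proof.
rewrite (shifts_ht g_geodesic g0 _ (gshiftqP (lattice_profile_dvd _))).
have p1 : (2 %| ht g (sample (cell x) (rmod n x)) - zsum (rmod n x))%Z.
  rewrite /sample; case: ifP => _; first exact: (frame_parity g_geodesic g0 n0 _ (f1_frame _)).
  exact: (frame_parity g_geodesic g0 n0 _ (f2_frame _)).
have p2 := dvdz_even_period g_periodic (lattice_profile_dvd (rdiv n x)).
have p3 : (2 %| zsum (rdiv n x *+ n))%Z.
  by rewrite zsum_mulrn -[zsum _ *+ n]mulr_natr natz; apply: dvdz_mull; lia.
by rewrite [in zsum x](rdiv_eq n x) zsumD; lia.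
Qed.

(** Different cells are separated by the margin [mu], different strips of a cell by the
    neighbourhoods of the kinks, and inside one strip the laminate is a single graph homomorphism up
    to a shift. *)
Lemma laminate_compat x y : good (cell x) -> good (cell y) ->
  compat g (nrm (x - y)) (laminate x) (laminate y).
Proof.
(* The 6mn are: 2mn for the height of each sample over the profile, mn for twice the depth, and mn
   for passing from points to cubes. *)
move=> gx gy; have sep_compat : `|lattice_profile (rdiv n x) - lattice_profile (rdiv n y)| + (6 * (m * n))%N%:Z
    <= n%:Z * (nrm (rdiv n x - rdiv n y))%:Z -> compat g (nrm (x - y)) (laminate x) (laminate y).
  move=> sep; apply: (compat_depth g_geodesic g0 (laminate_depth x) (laminate_depth y)).
  have := laminate_ht x; have := laminate_ht y; have := nrm_rdivB n0 x y.
  by move: sep; rewrite -PoszM; lia.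
have [zz|zz] := pselect (rdiv M (rdiv n x) = rdiv M (rdiv n y)); last first.
  apply: sep_compat; have [s1 s2] := cell_sep gx (or_introl gy) (or_introl zz).
  by apply: lattice_profile_sep s1 s2 _; exact: lattice_profile_affine.
have cE t z : dot t (rdiv n z) = dot t (cell z) + dot t (rdiv M (rdiv n z) *+ M).
  by rewrite {1}(rdiv_eq M (rdiv n z)) dotD.
have [[jj rr]|sep] := kink_free_sep L0 gx.2 gy.2; last first.
  apply: sep_compat.
  have cc : cell x - cell y = rdiv n x - rdiv n y.
    rewrite [in RHS](rdiv_eq M (rdiv n x)) [in RHS](rdiv_eq M (rdiv n y)) zz.
    by rewrite opprD addrACA subrr addr0.
  have -> : lattice_profile (rdiv n x) - lattice_profile (rdiv n y) = profile (cell x) - profile (cell y).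
    by rewrite /lattice_profile zz /cell; ring.
  have := profile_lip (cell x) (cell y); rewrite cc.
  (* The phase is 2n-Lipschitz, so phases 2nb apart belong to cubes at distance at least [b], where
     the slack is at least eb >= 6mn. *)
  have w_le : `|dot (fun k => t1 k - t2 k) (cell x - cell y)| <=
      (2 * n)%N%:Z * (nrm (cell x - cell y))%:Z.
    by apply: dot_le => k; have := t1_le k; have := t2_le k; lia.
  move: sep w_le; rewrite cc /phase opprD addrACA subrr addr0 -dotB cc -!PoszM => sep w_le.
  have bu : (b <= nrm (rdiv n x - rdiv n y))%N.
    by rewrite -(leq_pmul2l n0) -(leq_pmul2l (isT : 0 < 2)%N); lia.
  have : (e * b <= e * nrm (rdiv n x - rdiv n y))%N by rewrite leq_mul2l bu orbT.
  by move: eb; lia.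
have hom_compat h : graph_hom h -> compat g (nrm (x - y)) (h x) (h y).
  by move=> hh; apply: (compat_dist g_geodesic g0); rewrite nrmB; exact: graph_hom_dist.
have h1 i : graph_hom (f1 i) by case: (f1_frame i).
have h2 i : graph_hom (f2 i) by case: (f2_frame i).
case: (boolP (rising L (phase (cell x)))) => rx.
  have ry : rising L (phase (cell y)) by rewrite -rr.
  rewrite !laminate_rising //.
  (* On one rising piece the profile is [dot t1] plus a constant, so both points use the same
     shift. *)
  have -> : lattice_profile (rdiv n y) - dot t1 (rdiv n y) = lattice_profile (rdiv n x) - dot t1 (rdiv n x).
    rewrite !cE /lattice_profile zz -/(cell x) -/(cell y) /profile (zigzag_rising L0 rx) (zigzag_rising L0 ry) jj.
    by rewrite /phase !dot_diff; ring.
  apply: (shifts_compat g_geodesic g0 (gshiftqP _)).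
    by apply: rpredB; [exact: lattice_profile_dvd|exact: dot_dvd].
  exact: (hom_compat _ (mix_hom n0 (fun c => (a (rmod M c)).1) h1 f1_skel)).
have ry : ~~ rising L (phase (cell y)) by rewrite -rr.
rewrite !laminate_falling //.
have -> : lattice_profile (rdiv n y) - dot t2 (rdiv n y) = lattice_profile (rdiv n x) - dot t2 (rdiv n x).
  rewrite !cE /lattice_profile zz -/(cell x) -/(cell y) /profile (zigzag_falling L0 rx) (zigzag_falling L0 ry) jj.
  by ring.
apply: (shifts_compat g_geodesic g0 (gshiftqP _)).
  by apply: rpredB; [exact: lattice_profile_dvd|exact: dot_dvd].
exact: (hom_compat _ (mix_hom n0 (fun c => (a (rmod M c)).2) h2 f2_skel)).
Qed.

Lemma laminate_compat0 x : good (cell x) -> compat g (nrm x) (laminate x) (g 0).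
Proof.
move=> gx; have [s1 s2] := cell_sep (c' := 0) gx (or_intror erefl) (or_intror erefl).
have rdiv0 k : (0 < k)%N -> rdiv k 0 = 0 :> 'rV[int]_m.
  by move=> k0; apply: rdivP => // j; rewrite mul0rn subrr mxE; lia.
have := lattice_profile_sep (X := 0) s1 s2; rewrite rdiv0 // !dot0 !subr0 => /(_ _) sep.
apply: (compat_depth g_geodesic g0 (laminate_depth x) (depth_le_g g_geodesic g0 _ _)).
have := laminate_ht x; have := nrm_rdivB n0 x 0; rewrite rdiv0 // !subr0 ht_g //.
have {}sep := sep _; move: sep; rewrite -PoszM; lia.
Qed.

Lemma laminate_glue : exists H, [/\ frame g N T H, H 0 = g 0 &
  forall x, good (cell x) -> H x = laminate x].
Proof.
have NE c : c *+ N = (c *+ M) *+ n by rewrite mulrnA mulrnAC.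
have rdivN x c : rdiv n (x + c *+ N) = rdiv n x + c *+ M by rewrite NE rdivD.
have cellN x c : cell (x + c *+ N) = cell x by rewrite /cell rdivN rmodD.
apply: (@pinned_extension m d g g_geodesic g0 g_periodic N T N0 _ T_dvd _ [set x | good (cell x)] laminate).
- by rewrite oddM (negbTE n_even).
- move=> k; have := T_close k; have := t1_le k; have := t2_le k.
  move=> h2 h1 hT.
  have : `|M%:Z * (t1 k + t2 k)| <= M%:Z * (2 * n%:Z - 2 * e%:Z).
    by rewrite normrM; apply: ler_wpM2l; lia.
  have : (e * mu <= e * M)%N by rewrite leq_mul2l; apply/orP; right; lia.
  by rewrite PoszM; move: hT; lia.
- by move=> x c /=; rewrite cellN.
- move=> x c _; rewrite /laminate cellN rdivN NE rmodD // /lattice_profile rdivD // rmodD // dotD.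
  rewrite -gshiftqD ?lattice_profile_dvd ?dot_dvd //; congr (gshift g _ _); ring.
- by move=> x y; exact: laminate_compat.
- exact: laminate_compat0.
- by move=> x _; exact: laminate_parity.
- move=> x _; apply: depth_le_leq (laminate_depth x) => //.
  by apply: half_leq; rewrite leq_mul2l leq_pmulr ?orbT.
Qed.

End Laminate.

(** * Counting laminates *)

Section Counting.
Variables (R : realType) (m d : nat) (g : int -> tree d).
Hypothesis g_geodesic : two_sided_geodesic g.
Hypothesis g0 : g 0 = tree_root d.
Hypothesis g_periodic : periodic_geodesic g.
Hypothesis m2 : (2 <= m)%N.
Local Notation q := (even_period g).
Variables (n : nat) (t1 t2 : 'I_m -> int).
Hypotheses (n0 : (0 < n)%N) (n_even : ~~ odd n).
Hypotheses (t1_dvd : forall k, (q%:Z %| t1 k)%Z) (t2_dvd : forall k, (q%:Z %| t2 k)%Z).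
Variables (K1 K2 : nat).
Variables (f1 : 'I_K1 -> 'rV[int]_m -> tree d) (f2 : 'I_K2 -> 'rV[int]_m -> tree d).
Hypotheses (f1_inj : injective f1) (f2_inj : injective f2).
Hypotheses (f1_frame : forall i, frame g n t1 (f1 i))
           (f2_frame : forall i, frame g n t2 (f2 i)).
Hypotheses (f1_skel : forall i j x, skeleton n x -> f1 i x = f1 j x)
           (f2_skel : forall i j x, skeleton n x -> f2 i x = f2 j x).
Variables (b e J mu M1 : nat) (s : 'rV[R]_m).
Local Notation B := (n * b)%N.
Local Notation L := (2 * B * J)%N.
Local Notation M := (M1 + 2 * mu)%N.
Local Notation N := (n * M)%N.
Local Notation T := (target N g s).
Hypotheses (J0 : (0 < J)%N) (b0 : (0 < b)%N) (b_dvd : (q %| b)%N).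
Hypotheses (K1_gt0 : (0 < K1)%N) (K2_gt0 : (0 < K2)%N).
Hypotheses (t1_le : forall k, `|t1 k| + e%:Z <= n%:Z)
           (t2_le : forall k, `|t2 k| + e%:Z <= n%:Z).
Hypothesis eb : (6 * (m * n) <= e * b)%N.
Hypothesis T_close : forall k, `|2 * T k - M%:Z * (t1 k + t2 k)| <= (e * mu)%N%:Z.
Hypothesis e_mu : (4 * L + 12 * (m * n) <= e * mu)%N.

Local Notation ph := (phase t1 t2).
Local Notation gd theta := (good n t1 t2 b L mu M1 theta).
Local Notation lam theta := (laminate g n t1 t2 f1 f2 L mu M1 T theta).

Let L0 : (0 < L)%N. Proof. by rewrite !muln_gt0 n0 b0 J0. Qed.

Let N0 : (0 < N)%N.
Proof.
rewrite muln_gt0 n0 /=; have := e_mu; case: (posnP mu) => [->|]; last by lia.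
have : (0 < m * n)%N by rewrite muln_gt0 n0 andbT; lia.
by rewrite muln0; move: (m * n)%N L => u v; lia.
Qed.

Let L_dvd : (q%:Z %| L%:Z)%Z.
Proof. by rewrite dvdzE /= dvdn_mulr // dvdn_mull // dvdn_mull. Qed.

Lemma phase_shift theta c : ph (theta + L%:Z) c = ph theta c + L%:Z.
Proof. by rewrite /phase addrA. Qed.

Lemma good_shift theta c : gd (theta + L%:Z) c <-> gd theta c.
Proof. by rewrite /good phase_shift kink_free_shift. Qed.

Lemma laminate_ex theta (a : 'rV[int]_m -> 'I_K1 * 'I_K2) :
  0 <= theta -> theta <= 3 * L%:Z -> (q%:Z %| theta)%Z ->
  exists2 H, Hset N g s H & forall x, gd theta (cell n mu M1 x) -> H x = lam theta a x.
Proof.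
move=> th0 thL thq.
have [H [Hf H0 HE]] := laminate_glue g_geodesic g0 g_periodic m2 n0 n_even t1_dvd t2_dvd
  f1_frame f2_frame f1_skel f2_skel L0 L_dvd t1_le t2_le
  (fun k => dvdz_target g N s k) eb T_close e_mu th0 thL thq a.
by exists H => //; apply: frame_Hset.
Qed.

(** On the cube [c] the laminate is an injective shift of the sample, and a frame is determined by
    its values on one cube. *)
Lemma laminate_recover theta a a' H c : (q%:Z %| theta)%Z -> gd theta c ->
  (forall x, gd theta (cell n mu M1 x) -> H x = lam theta a x) ->
  (forall x, gd theta (cell n mu M1 x) -> H x = lam theta a' x) ->
  if rising L (ph theta c) then (a c).1 = (a' c).1 else (a c).2 = (a' c).2.
Proof.
move=> thq gc Ha Ha'.
have cellE y : rmod n y = y -> cell n mu M1 (c *+ n + y) = c.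
  move=> yE; have [gc1 _] := gc; have y0 : rdiv n y = 0.
    by apply: rdivP => // k; rewrite mul0rn subr0 -yE rmod_ge0 ?rmod_lt.
  rewrite /cell addrC rdivD // y0 add0r.
  have c0 : rdiv M c = 0.
    apply: rdivP => [|k]; first by have := gc1 (Ordinal (ltnW m2)); lia.
    by rewrite mul0rn subr0; have := gc1 k; move: (c 0 k) => v; lia.
  by rewrite {2}(rdiv_eq M c) c0 mul0rn addr0.
have sampleE y : rmod n y = y -> sample t1 t2 f1 f2 L theta a c y = sample t1 t2 f1 f2 L theta a' c y.
  move=> yE; have := Ha (c *+ n + y); have := Ha' (c *+ n + y); rewrite cellE // => -> // /(_ gc).
  have xy : rmod n (c *+ n + y) = y by rewrite addrC rmodD.
  by rewrite /laminate cellE // xy => /gshift_inj.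
have rmodK y : rmod n (rmod n y) = rmod n y.
  have := rmodD (rmod n y) (rdiv n y) n0; by rewrite -rdiv_eq.
move: sampleE; rewrite /sample; case: ifP => _ sampleE.
  apply: f1_inj; apply/funext => y.
  by rewrite !(frame_rmod g_geodesic g0 g_periodic t1_dvd y (f1_frame _)) sampleE.
apply: f2_inj; apply/funext => y.
by rewrite !(frame_rmod g_geodesic g0 g_periodic t2_dvd y (f2_frame _)) sampleE.
Qed.

Definition corner (c : {ffun 'I_m -> 'I_M1}) : 'rV[int]_m := \row_k ((c k : nat)%:Z + mu%:Z).

Lemma corner_inj : injective corner.
Proof.
move=> c c' /rowP cc; apply/ffunP => k; apply: val_inj; have := cc k.
by rewrite !mxE => /addIr [].
Qed.

Lemma corner_good theta c : kink_free L B (ph theta (corner c)) -> gd theta (corner c).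
Proof.
move=> kf; split=> // k; rewrite mxE; have := ltn_ord (c k).
by move: (c k : nat) => v; lia.
Qed.

(* The phases [theta] and [theta + L] exchange the two slopes, so together they
   use every cube once with each slope. *)
Lemma laminate_count (theta : int) : 0 <= theta -> theta <= 2 * L%:Z -> (q%:Z %| theta)%Z ->
  ((K1 * K2) ^ #|[pred c | kink_free L B (ph theta (corner c))]|
     <= #|` fset_set (Hset N g s)| ^ 2)%N.
Proof.
move=> th0 thL thq.
set P := [pred c | kink_free L B (ph theta (corner c))].
pose X := {c | P c}; pose dflt := (Ordinal K1_gt0, Ordinal K2_gt0).
(* Free choices are made on the kink-free cubes of the filled part of a cell; all other cubes
   receive [dflt]. *)
pose ass (al : {ffun X -> 'I_K1 * 'I_K2}) (c : 'rV[int]_m) : 'I_K1 * 'I_K2 :=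
  if [pick y : X | corner (val y) == c] is Some y then al y else dflt.
have assE al (y : X) : ass al (corner (val y)) = al y.
  rewrite /ass; case: pickP => [y' /eqP/corner_inj/val_inj -> //|/(_ y)].
  by rewrite eqxx.
have LE : theta + L%:Z <= 3 * L%:Z by lia.
have L_ge0 : 0 <= theta + L%:Z by lia.
have Lq : (q%:Z %| theta + L%:Z)%Z by exact: rpredD.
have th3 : theta <= 3 * L%:Z by lia.
have ex al : exists HH : ('rV[int]_m -> tree d) * ('rV[int]_m -> tree d),
    (Hset N g s `*` Hset N g s) HH /\
    (forall x, gd theta (cell n mu M1 x) -> HH.1 x = lam theta (ass al) x) /\
    (forall x, gd (theta + L%:Z) (cell n mu M1 x) -> HH.2 x = lam (theta + L%:Z) (ass al) x).
  have [H1 H1H H1E] := laminate_ex (ass al) th0 th3 thq.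
  have [H2 H2H H2E] := laminate_ex (ass al) L_ge0 LE Lq.
  by exists (H1, H2).
have [F FP] := choice ex.
(* On a given cube one laminate reveals the first index and the other the second, as shifting the
   phase by [L] exchanges rising and falling pieces. *)
have F_inj : injective F.
  move=> al al' FF; apply/ffunP => y; rewrite -!assE.
  have [_ [E1 E2]] := FP al; have [_ [E1' E2']] := FP al'; rewrite -FF in E1' E2'.
  have gy : gd theta (corner (val y)) by apply: corner_good; exact: (valP y).
  have gy' : gd (theta + L%:Z) (corner (val y)) by exact/good_shift.
  have := laminate_recover thq gy E1 E1'; have := laminate_recover Lq gy' E2 E2'.
  rewrite phase_shift rising_shift //; case: (rising _ _) => /= e1 e2.
    by rewrite [LHS]surjective_pairing [RHS]surjective_pairing e1 e2.
  by rewrite [LHS]surjective_pairing [RHS]surjective_pairing e1 e2.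
have fH := Hset_finite g_geodesic g0 g_periodic s N0.
have := inj_card_fset_set (finite_setX fH fH) F_inj (fun al => (FP al).1).
move=> le_card; apply: leq_trans (leq_trans le_card (card_fset_setX fH)).
by rewrite card_ffun card_prod !card_ord card_sig.
Qed.

(** Each cube is near a kink for at most one of the J phases 2Bi, so the phase with the fewest lost
    cubes loses at most a proportion 1/J. *)
Lemma kink_free_average : exists theta : int, [/\ 0 <= theta, theta <= 2 * L%:Z, (q%:Z %| theta)%Z &
  (J * M1 ^ m <= J * #|[pred c | kink_free L B (ph theta (corner c))]| + M1 ^ m)%N].
Proof.
clear - n0 J0 b0 b_dvd L0.
pose bad (i : 'I_J) := [pred c | ~~ kink_free L B (ph (2 * B * i)%N%:Z (corner c))].
have sum_bad : (\sum_i #|bad i| <= M1 ^ m)%N.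
  under eq_bigr do rewrite -sum1_card big_mkcond /=.
  rewrite exchange_big /= -[(M1 ^ m)%N]muln1.
  have <- : #|{ffun 'I_m -> 'I_M1}| = (M1 ^ m)%N by rewrite card_ffun !card_ord.
  rewrite -sum_nat_const; apply: leq_sum => c _.
  have le1 := kink_free_translate L0 (dot (fun k => t1 k - t2 k) (corner c)) (erefl L).
  rewrite -big_mkcond sum1_card /=; apply: leq_trans le1.
  by apply: eq_leq; apply: eq_card => i; rewrite !inE.
pose i0 := [arg min_(i < Ordinal J0) #|bad i|]%N.
have bad0 : (J * #|bad i0| <= M1 ^ m)%N.
  apply: leq_trans sum_bad; rewrite -[J in (J * _)%N]card_ord -sum_nat_const leq_sum // => i _.
  by rewrite /i0; case: arg_minnP => // i' _; apply.
exists (2 * B * i0)%N%:Z; split=> //.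
- have := ltn_ord i0; move: (2 * B)%N (i0 : nat) => u v vJ.
  by rewrite -PoszM lez_nat; nia.
- by rewrite dvdzE /= dvdn_mulr // dvdn_mull // dvdn_mull.
- have := cardC (bad i0); rewrite card_ffun !card_ord.
  have -> : #|predC (bad i0)| = #|[pred c | kink_free L B (ph (2 * B * i0)%N%:Z (corner c))]|.
    by apply: eq_card => c; rewrite !inE negbK.
  by move=> bE; rewrite -[X in (J * X <= _)%N]bE mulnDr addnC leq_add2l.
Qed.

End Counting.

(** * The midpoint inequality *)

Section MidpointBound.
Variables (R : realType) (m d : nat) (g : int -> tree d).
Hypothesis g_geodesic : two_sided_geodesic g.
Hypothesis g0 : g 0 = tree_root d.
Hypothesis g_periodic : periodic_geodesic g.
Hypothesis m2 : (2 <= m)%N.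
Local Notation q := (even_period g).
Implicit Types (s : 'rV[R]_m) (n : nat) (k : 'I_m).

Lemma target_approx n s k : `|(target n g s k)%:~R - s 0 k * n%:R| <= q%:R :> R.
Proof.
have q0 : 0 < (q%:R : R) by rewrite ltr0n even_period_gt0.
set x : R := s 0 k * n%:R; have -> : x = q%:R * (x / q%:R) by rewrite mulrCA divff ?mulr1 ?gt_eqF.
have -> : (target n g s k)%:~R = q%:R * (Num.floor (x / q%:R))%:~R :> R.
  by rewrite /target intrM -pmulrn.
rewrite -mulrBr normrM gtr0_norm // ger_pMr //.
have /andP[f1 f2] := floor_itv (x / q%:R).
by move: f2; rewrite intrD => f2; rewrite ler_norml; apply/andP; split; lra.
Qed.

(** Of the margin 2/p, one half covers the rounding error q <= n/p and the other the slack e <=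
    n/p. *)
Lemma target_le n s k p e : (0 < p)%N -> `|s 0 k| + 2 / p%:R <= 1 ->
  (p * q <= n)%N -> (p * e <= n)%N -> `|target n g s k| + e%:Z <= n%:Z.
Proof.
move=> p0 sp pq pe; have p0R : 0 < (p%:R : R) by rewrite ltr0n.
rewrite -(ler_int R) intrD intr_norm -!pmulrn.
have := target_approx n s k; set t : R := (target n g s k)%:~R => tn.
have {}sp : `|s 0 k| * p%:R + 2 <= p%:R :> R.
  by move: sp; rewrite -(ler_pM2r p0R) mulrDl mulfVK ?gt_eqF // mul1r.
have {}pq : p%:R * q%:R <= n%:R :> R by rewrite -natrM ler_nat.
have {}pe : p%:R * e%:R <= n%:R :> R by rewrite -natrM ler_nat.
have n_ge0 : 0 <= n%:R :> R by [].
have t_le : `|t| <= `|s 0 k| * n%:R + q%:R.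
  have := ler_normD (t - s 0 k * n%:R) (s 0 k * n%:R); rewrite subrK normrM (ger0_norm n_ge0).
  by move=> le1; apply: le_trans le1 _; rewrite addrC lerD2l.
rewrite -(ler_pM2l p0R).
have h1 : p%:R * `|t| <= p%:R * (`|s 0 k| * n%:R + q%:R) by rewrite ler_pM2l.
have h2 : (`|s 0 k| * p%:R + 2) * n%:R <= p%:R * n%:R by apply: ler_wpM2r.
by rewrite mulrDr in h1 *; rewrite mulrDl in h2; lra.
Qed.

(** Extend the values prescribed on the period lattice alone. *)
Lemma Hset_nonempty n s : (0 < n)%N -> ~~ odd n ->
  (forall k, `|target n g s k| <= n%:Z) -> exists h, Hset n g s h.
Proof.
move=> n0 n_even t_le; have t_dvd k := dvdz_target g n s k.
have [||||||H [Hf H0 _]] := @pinned_extension m d g g_geodesic g0 g_periodic n (target n g s)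
  n0 n_even t_dvd t_le set0 (fun=> tree_root d) => //.
by exists H; exact: frame_Hset.
Qed.

Definition configurations n s : nat := #|` fset_set (Hset n g s)|.

Lemma configurations_gt0 n s : (0 < n)%N -> ~~ odd n ->
  (forall k, `|target n g s k| <= n%:Z) -> (0 < configurations n s)%N.
Proof.
move=> n0 n_even t_le; have [h hH] := Hset_nonempty n0 n_even t_le.
rewrite /configurations cardfs_gt0; apply/fset0Pn; exists h.
by rewrite in_fset_set ?inE //; exact: Hset_finite.
Qed.

(** A cell has (J+2)mu cubes per side, of which J mu are filled. Large [n] lets [e] absorb the
    rounding of the three targets; large [mu] lets the margins absorb the amplitude of the
    zigzag. *)
Lemma configurations_laminate n J mu p s1 s2 s : (0 < n)%N -> ~~ odd n ->
  (0 < J)%N -> (0 < p)%N ->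
  (forall k, `|s1 0 k| + 2 / p%:R <= 1) -> (forall k, `|s2 0 k| + 2 / p%:R <= 1) ->
  (forall k, 2 * s 0 k = s1 0 k + s2 0 k) ->
  (4 * q * (J + 2) * p <= n)%N ->
  (2 * p * (8 * (12 * m * p * q) * J + 12 * m) <= mu)%N ->
  exists K1 K2, [/\ (0 < K1)%N, (0 < K2)%N,
    (configurations n s1 <= (2 * d.+1) ^ ((4 * m + m * m) * n ^ m.-1) * K1)%N,
    (configurations n s2 <= (2 * d.+1) ^ ((4 * m + m * m) * n ^ m.-1) * K2)%N &
    ((K1 * K2) ^ (J.-1 * (J * mu) ^ m) <=
       configurations (n * (J * mu + 2 * mu)) s ^ (2 * J))%N].
Proof.
move=> n0 n_even J0 p0 s1p s2p s12 n_large mu_large.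
have q0 : (0 < q)%N := even_period_gt0 g_periodic.
(* As n <= 2pe, this [b] satisfies 6mn <= eb; its factor [q] makes the length of the linear pieces a
   multiple of [q]. *)
pose e := (n %/ p)%N; pose b := (12 * m * p * q)%N.
have pe : (p * e <= n)%N by rewrite mulnC leq_trunc_div.
have pq : (p * q <= n)%N by apply: leq_trans n_large; nia.
have e_large : (4 * q * (J + 2) <= e)%N by rewrite leq_divRL.
have e0 : (0 < e)%N by apply: leq_trans e_large; rewrite !muln_gt0 q0 addn_gt0 orbT.
have n_le : (n <= 2 * p * e)%N.
  have := divn_eq n p; have := ltn_pmod n p0; rewrite -/e; nia.
have t1_le k := target_le p0 (s1p k) pq pe.
have t2_le k := target_le p0 (s2p k) pq pe.
have t1_dvd k := dvdz_target g n s1 k.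
have t2_dvd k := dvdz_target g n s2 k.
have Z1 : (0 < configurations n s1)%N.
  by apply: configurations_gt0 => // k; have := t1_le k; lia.
have Z2 : (0 < configurations n s2)%N.
  by apply: configurations_gt0 => // k; have := t2_le k; lia.
have [K1 [f1 [f1_inj f1_frame f1_skel K1_le]]] := samples g_geodesic g0 g_periodic s1 n0 m2.
have [K2 [f2 [f2_inj f2_frame f2_skel K2_le]]] := samples g_geodesic g0 g_periodic s2 n0 m2.
have K1_gt0 : (0 < K1)%N.
  by case: posnP => // K1_0; move: (leq_trans Z1 K1_le); rewrite K1_0 muln0.
have K2_gt0 : (0 < K2)%N.
  by case: posnP => // K2_0; move: (leq_trans Z2 K2_le); rewrite K2_0 muln0.
exists K1, K2; split=> //.
have b0 : (0 < b)%N by rewrite !muln_gt0 p0 q0 !andbT; lia.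
have b_dvd : (q %| b)%N by rewrite dvdn_mull.
have eb : (6 * (m * n) <= e * b)%N.
  apply: (@leq_trans (6 * (m * (2 * p * e)))%N).
    by rewrite leq_mul2l /= leq_mul2l n_le orbT.
  rewrite /b; have -> : (e * (12 * m * p * q) = 6 * (m * (2 * p * e)) * q)%N by ring.
  by rewrite leq_pmulr.
have mu0 : (0 < mu)%N by apply: leq_trans mu_large; rewrite !muln_gt0 p0 addn_gt0; lia.
set N := (n * (J * mu + 2 * mu))%N.
have T_close k : `|2 * target N g s k - (J * mu + 2 * mu)%N%:Z *
    (target n g s1 k + target n g s2 k)| <= (e * mu)%N%:Z.
  have := target_approx N s k; have := target_approx n s1 k; have := target_approx n s2 k.
  move: (target N g s k) (target n g s1 k) (target n g s2 k) => Tz t1z t2z.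
  set T : R := Tz%:~R; set t1 : R := t1z%:~R; set t2 : R := t2z%:~R; set Mr : R := (J * mu + 2 * mu)%N%:R => a2 a1 a.
  have Mr1 : 1 <= Mr by rewrite /Mr (ler_nat R 1); lia.
  have NE : N%:R = n%:R * Mr :> R by rewrite /N natrM.
  have dec : 2 * T - Mr * (t1 + t2) = 2 * (T - s 0 k * N%:R)
      - Mr * (t1 - s1 0 k * n%:R) - Mr * (t2 - s2 0 k * n%:R).
    have sE : s 0 k = (s1 0 k + s2 0 k) / 2 by rewrite -s12 mulrAC divff ?mul1r.
    by rewrite NE sE; field.
  have emu : 4 * q%:R * Mr <= (e * mu)%N%:R :> R.
    rewrite /Mr -!natrM ler_nat -mulnDl mulnA leq_mul2r; apply/orP; right.
    exact: e_large.
  rewrite -(ler_int R); apply: le_trans emu.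
  have -> : (`|2 * Tz - (J * mu + 2 * mu)%N%:Z * (t1z + t2z)|)%:~R = `|2 * T - Mr * (t1 + t2)|.
    by rewrite intr_norm intrB !intrM [(t1z + t2z)%:~R]intrD -!pmulrn.
  rewrite dec.
  have M_ge0 : 0 <= Mr by lra.
  have q_ge0 : 0 <= q%:R :> R by [].
  have b1 : `|Mr * (t1 - s1 0 k * n%:R)| <= Mr * q%:R by rewrite normrM (ger0_norm M_ge0) ler_wpM2l.
  have b2 : `|Mr * (t2 - s2 0 k * n%:R)| <= Mr * q%:R by rewrite normrM (ger0_norm M_ge0) ler_wpM2l.
  have b3 : q%:R <= Mr * q%:R by rewrite ler_peMl.
  move: a b1 b2 b3; move: (T - _) (Mr * (t1 - _)) (Mr * (t2 - _)) => u v w.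
  rewrite !ler_norml => /andP[? ?] /andP[? ?] /andP[? ?] ?.
  by apply/andP; split; lra.
have e_mu : (4 * (2 * (n * b) * J) + 12 * (m * n) <= e * mu)%N.
  have -> : (4 * (2 * (n * b) * J) + 12 * (m * n) = n * (8 * b * J + 12 * m))%N by ring.
  apply: leq_trans (_ : 2 * p * e * (8 * b * J + 12 * m) <= _)%N; first by rewrite leq_mul2r n_le orbT.
  have -> : (2 * p * e * (8 * b * J + 12 * m) = e * (2 * p * (8 * b * J + 12 * m)))%N by ring.
  by rewrite leq_mul2l mu_large orbT.
have [theta [th0 thL thq avg]] := kink_free_average (target n g s1) (target n g s2)
  n0 mu (J * mu) J0 b0 b_dvd.
have := laminate_count g_geodesic g0 g_periodic m2 n0 n_even t1_dvd t2_dvd f1_inj f2_inj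
  f1_frame f2_frame f1_skel f2_skel J0 b0 b_dvd K1_gt0 K2_gt0 t1_le t2_le eb T_close e_mu
  th0 thL thq.
(* The average gives (J-1)(J mu)^m <= JG, so the J-th power of the count has the required
   exponent. *)
move: avg; set G := #|_| => avg count.
rewrite [leqRHS]expnM; apply: leq_trans (_ : ((K1 * K2) ^ G) ^ J <= _)%N; last by rewrite leq_exp2r.
rewrite -expnM leq_pexp2l ?muln_gt0 ?K1_gt0 //.
by move: avg; case: (J) J0 => // J' _ /=; rewrite mulSn [(G * _)%N]mulnC; lia.
Qed.

(** The logarithmic cost, per n^(m-1), of restricting to one class of samples. *)
Definition entropy_error : R := (4 * m + m * m)%N%:R * ln (2 * d.+1)%N%:R.

(* The proportion of the cubes of a cell that carry a sample. *)
Definition filling (J : nat) : R := J.-1%:R / J%:R * (J%:R / (J + 2)%N%:R) ^+ m.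

(** Take logarithms in the count and divide by 2J times the volume of the cell; the cost of order
    n^(m-1) becomes of order 1/n after division by n^m. *)
Lemma ent_laminate n J mu p s1 s2 s : (0 < n)%N -> ~~ odd n ->
  (0 < J)%N -> (0 < p)%N ->
  (forall k, `|s1 0 k| + 2 / p%:R <= 1) -> (forall k, `|s2 0 k| + 2 / p%:R <= 1) ->
  (forall k, 2 * s 0 k = s1 0 k + s2 0 k) ->
  (4 * q * (J + 2) * p <= n)%N ->
  (2 * p * (8 * (12 * m * p * q) * J + 12 * m) <= mu)%N ->
  ent_n (n * (J * mu + 2 * mu)) g s <=
    filling J / 2 * (ent_n n g s1 + ent_n n g s2 + 2 * entropy_error / n%:R).
Proof.
move=> n0 n_even J0 p0 s1p s2p s12 n_large mu_large.
have [K1 [K2 [K1_gt0 K2_gt0 Z1 Z2 ZJ]]] :=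
  configurations_laminate n0 n_even J0 p0 s1p s2p s12 n_large mu_large.
have mu0 : (0 < mu)%N.
  apply: leq_trans mu_large; rewrite !muln_gt0 p0 addn_gt0 (_ : (0 < 12 * m)%N) ?orbT //.
  by rewrite muln_gt0; exact: ltnW.
have natpos (i : nat) : (0 < i)%N -> (i%:R : R) \is Num.pos by move=> i0; rewrite posrE ltr0n.
set N := (n * (J * mu + 2 * mu))%N in ZJ *.
set Z := configurations N s in ZJ.
have Z0 : (0 < Z)%N.
  have : (0 < Z ^ (2 * J))%N by apply: leq_trans ZJ; rewrite expn_gt0 muln_gt0 K1_gt0 K2_gt0.
  by rewrite expn_gt0 => /orP[//|]; rewrite muln_eq0 /= => /eqP JE; move: J0; rewrite JE.
have A0 : (0 < 2 * d.+1)%N by rewrite muln_gt0.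
have lnZ_i K si : (0 < K)%N ->
    (configurations n si <= (2 * d.+1) ^ ((4 * m + m * m) * n ^ m.-1) * K)%N ->
    ln (configurations n si)%:R <= entropy_error * n%:R ^+ m.-1 + ln K%:R :> R.
  move=> K_gt0 Z_le; have [->|Zi0] := posnP (configurations n si).
    by rewrite ln0 // addr_ge0 ?ln_ge0 ?(ler_nat R 1) // mulr_ge0 ?exprn_ge0 //
      mulr_ge0 // ln_ge0 // (ler_nat R 1).
  have E0 : (0 < (2 * d.+1) ^ ((4 * m + m * m) * n ^ m.-1))%N by rewrite expn_gt0 A0.
  have -> : entropy_error * n%:R ^+ m.-1 + ln K%:R =
      ln ((2 * d.+1) ^ ((4 * m + m * m) * n ^ m.-1) * K)%N%:R.
    rewrite natrM (lnM (natpos _ E0) (natpos _ K_gt0)) natrX lnXn ?ltr0n //.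
    rewrite /entropy_error -[ln _ *+ _]mulr_natr [((_ + _) * _)%N%:R]natrM [(n ^ _)%:R]natrX.
    by congr (_ + _); ring.
  by rewrite (ler_ln (natpos _ Zi0) (natpos _ _)) ?ler_nat // muln_gt0 E0.
have lnZ : (J.-1 * (J * mu) ^ m)%N%:R * (ln K1%:R + ln K2%:R) <= (2 * J)%N%:R * ln Z%:R :> R.
  have K12 : (0 < K1 * K2)%N by rewrite muln_gt0 K1_gt0.
  rewrite -(lnM (natpos _ K1_gt0) (natpos _ K2_gt0)) -natrM !mulr_natl -!lnXn ?ltr0n //.
  by rewrite -!natrX (ler_ln (natpos _ _) (natpos _ _)) ?ler_nat ?expn_gt0 ?K12 ?Z0.
have {}Z1 := lnZ_i _ _ K1_gt0 Z1; have {}Z2 := lnZ_i _ _ K2_gt0 Z2.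
rewrite /ent_n -/(configurations n s1) -/(configurations n s2) -/(configurations N s) -/Z.
move: Z1 Z2 lnZ; set l1 := ln (configurations n s1)%:R; set l2 := ln (configurations n s2)%:R.
set l := ln Z%:R; move: (ln K1%:R) (ln K2%:R) => k1 k2 Z1 Z2 lnZ.
have x0 : 0 < (n%:R : R) by rewrite ltr0n.
have mu0R : 0 < (mu%:R : R) by rewrite ltr0n.
have J0R : 0 < (J%:R : R) by rewrite ltr0n.
have J2R : 0 < ((J + 2)%N%:R : R) by rewrite ltr0n addn_gt0 J0.
have NE : N%:R ^+ m = n%:R ^+ m * ((J + 2)%N%:R ^+ m * mu%:R ^+ m) :> R.
  by rewrite /N -mulnDl !natrM !exprMn.
have VE : (J.-1 * (J * mu) ^ m)%N%:R = J.-1%:R * (J%:R ^+ m * mu%:R ^+ m) :> R.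
  by rewrite natrM natrX natrM exprMn.
have XE : n%:R ^+ m = n%:R * n%:R ^+ m.-1 :> R by rewrite -exprS prednK //; lia.
rewrite VE natrM in lnZ.
have X0 : 0 < n%:R ^+ m.-1 :> R by rewrite exprn_gt0.
have mum0 : 0 < mu%:R ^+ m :> R by rewrite exprn_gt0.
have Jm0 : 0 < J%:R ^+ m :> R by rewrite exprn_gt0.
have J2m0 : 0 < (J + 2)%N%:R ^+ m :> R by rewrite exprn_gt0.
rewrite NE XE /filling expr_div_n.
move: lnZ Z1 Z2 X0 mum0 Jm0 J2m0 J0R J2R x0.
have J1 : 0 <= J.-1%:R :> R by [].
move: (n%:R ^+ m.-1 : R) (mu%:R ^+ m : R) (J%:R ^+ m : R) ((J + 2)%N%:R ^+ m : R).
move: (J%:R : R) (J.-1%:R : R) (n%:R : R) J1.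
move=> j j1 x j1_ge0 X Mm Jm J2m lnZ Z1 Z2 X0 Mm0 Jm0 J2m0 j0 _ x0.
have key : j1 * (Jm * Mm) * (l1 + l2 - 2 * entropy_error * X) <= 2 * j * l.
  apply: le_trans lnZ; apply: ler_wpM2l; last by lra.
  by rewrite !mulr_ge0 // ltW.
have D0 : 0 < 2 * j * (x * X * (J2m * Mm)) by rewrite !mulr_gt0.
rewrite -(ler_pM2l D0).
have -> : 2 * j * (x * X * (J2m * Mm)) * - (l / (x * X * (J2m * Mm))) = - (2 * j * l).
  by field; rewrite !gt_eqF.
have -> : 2 * j * (x * X * (J2m * Mm)) * (j1 / j * (Jm / J2m) / 2 *
    (- (l1 / (x * X)) + - (l2 / (x * X)) + 2 * entropy_error / x)) =
    - (j1 * (Jm * Mm) * (l1 + l2 - 2 * entropy_error * X)).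
  by field; rewrite !gt_eqF.
by rewrite lerN2.
Qed.

End MidpointBound.

(** * Convexity *)

Section Ball.
Variables (R : realType) (m : nat).
Implicit Types (a b x : 'rV[R]_m) (t : R).

Lemma l1norm_entry x k : `|x 0 k| <= l1norm x.
Proof. by rewrite /l1norm (bigD1 k) //= lerDl sumr_ge0. Qed.

Lemma l1norm_conv t a b : 0 <= t <= 1 ->
  l1norm (t *: a + (1 - t) *: b) <= t * l1norm a + (1 - t) * l1norm b.
Proof.
move=> /andP[t0 t1]; rewrite /l1norm !mulr_sumr -big_split /=; apply: ler_sum => k _.
rewrite !mxE; apply: le_trans (ler_normD _ _) _.
have t1' : 0 <= 1 - t by rewrite subr_ge0.
by rewrite !normrM (ger0_norm t0) (ger0_norm t1').
Qed.

Lemma l1norm_conv_lt t a b : 0 <= t -> t < 1 -> l1norm a <= 1 -> l1norm b < 1 ->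
  l1norm (t *: a + (1 - t) *: b) < 1.
Proof.
move=> t0 t1 a1 b1; have t01 : 0 <= t <= 1 by rewrite t0 ltW.
apply: le_lt_trans (l1norm_conv a b t01) _.
have : t * l1norm a <= t * 1 by apply: ler_wpM2l.
have : (1 - t) * l1norm b < (1 - t) * 1 by rewrite ltr_pM2l // subr_gt0.
by lra.
Qed.

Variable f : 'rV[R]_m -> R.
Hypothesis f_le0 : forall x, f x <= 0.
Hypothesis f_mid : forall a b x, l1norm a < 1 -> l1norm b < 1 ->
  (forall k, 2 * x 0 k = a 0 k + b 0 k) -> f x <= (f a + f b) / 2.
Hypothesis f_boundary : forall x, ~~ (l1norm x < 1) -> f x = 0.

(* The gap between [f] and its chord is bounded, and midpoint convexity halves
   the bound. *)
Lemma midpoint_convex_inside t a b : 0 <= t <= 1 -> l1norm a < 1 -> l1norm b < 1 ->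
  f (t *: a + (1 - t) *: b) <= t * f a + (1 - t) * f b.
Proof.
move=> t01 a1 b1; pose x u := u *: a + (1 - u) *: b.
pose gap u := f (x u) - (u * f a + (1 - u) * f b).
have x_in (u : R) : 0 <= u <= 1 -> l1norm (x u) < 1.
  move=> u01; apply: le_lt_trans (l1norm_conv a b u01) _.
  have /andP[u0 u1] := u01.
  have [->|u0'] := eqVneq u 0; first by rewrite mul0r subr0 mul1r add0r.
  have : u * l1norm a < u * 1 by rewrite ltr_pM2l // lt_neqAle eq_sym u0'.
  have : (1 - u) * l1norm b <= (1 - u) * 1 by apply: ler_wpM2l; [lra | exact: ltW].
  by lra.
have x0 : x 0 = b by rewrite /x scale0r add0r subr0 scale1r.
have x1 : x 1 = a by rewrite /x scale1r subrr scale0r addr0.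
have gap_mid (u v : R) : 0 <= u <= 1 -> 0 <= v <= 1 -> gap ((u + v) / 2) <= (gap u + gap v) / 2.
  move=> u01 v01; have : f (x ((u + v) / 2)) <= (f (x u) + f (x v)) / 2.
    apply: f_mid; rewrite ?x_in // => k; rewrite /x !mxE; field => //.
  by rewrite /gap; lra.
have gap_le : forall (n : nat) (u : R), 0 <= u <= 1 -> gap u <= (- f a - f b) / 2 ^+ n.
  elim=> [|n IH] u u01.
    rewrite expr0 divr1 /gap; have := f_le0 (x u); have := f_le0 a; have := f_le0 b.
    move: (f (x u)) (f a) (f b) => X A B B0 A0 X0; have /andP[u0 u1] := u01.
    have : 0 <= (1 - u) * - A by apply: mulr_ge0; lra.
    have : 0 <= u * - B by apply: mulr_ge0; lra.
    by lra.
  have -> : (- f a - f b) / 2 ^+ n.+1 = ((- f a - f b) / 2 ^+ n) / 2.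
    by rewrite exprS; field; rewrite expf_neq0.
  (* A point of [0,1] is the midpoint of 2u and 0, or of 2u - 1 and 1, and the gap vanishes at 0 and
     1. *)
  have [u2|u2] := leP u (1 / 2).
    have := gap_mid (2 * u) 0; rewrite (_ : (2 * u + 0) / 2 = u); last by field.
    have -> : gap 0 = 0 by rewrite /gap x0; lra.
    have := IH (2 * u); move: u01 => /andP[u0 u1] h1 h2.
    by have := h1 ltac:(apply/andP; split; lra); have := h2 ltac:(apply/andP; split; lra) ltac:(apply/andP; split; lra); lra.
  have := gap_mid (2 * u - 1) 1; rewrite (_ : (2 * u - 1 + 1) / 2 = u); last by field.
  have -> : gap 1 = 0 by rewrite /gap x1; lra.
  have := IH (2 * u - 1); move: u01 => /andP[u0 u1] h1 h2.
  by have := h1 ltac:(apply/andP; split; lra); have := h2 ltac:(apply/andP; split; lra) ltac:(apply/andP; split; lra); lra.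
rewrite -subr_le0 -/(gap t); rewrite leNgt; apply/negP => gap_gt0.
set C := - f a - f b in gap_le.
have C_ge0 : 0 <= C by rewrite /C; have := f_le0 a; have := f_le0 b; lra.
pose n := Num.truncn (C / gap t); have := gap_le n.+1 t t01.
have Cn : C / gap t < n.+1%:R by exact: truncnS_gt.
rewrite ler_pdivlMr ?exprn_gt0 //; apply/negP; rewrite -ltNge.
rewrite ltr_pdivrMr // in Cn; apply: lt_trans Cn _.
by rewrite mulrC ltr_pM2l // -natrX ltr_nat ltn_expl.
Qed.

(** Replace [a] by the interior point y = (a + eta b)/(1 + eta) and express the same combination
    through [y] and [b]. The value at [y] is at most 0, the boundary value, and the weight of [b]
    changes only by t eta. *)
Lemma midpoint_convex_boundary t a b : 0 <= t <= 1 -> l1norm a <= 1 -> l1norm b < 1 ->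
  f (t *: a + (1 - t) *: b) <= t * f a + (1 - t) * f b.
Proof.
move=> t01 a1 b1; have [a_in|a_out] := boolP (l1norm a < 1).
  exact: midpoint_convex_inside.
have /andP[t0 t1] := t01; have [->|t1'] := eqVneq t 1.
  by rewrite scale1r subrr scale0r addr0 mul1r mul0r addr0.
have {}t1 : t < 1 by rewrite lt_neqAle t1'.
rewrite (f_boundary a_out) mulr0 add0r; apply/ler_addgt0Pr => eps eps0.
(* The first bound keeps the weight t(1 + eta) at most 1, the second makes the error at most [eps];
   1 - f b is used since it is positive. *)
have fb := f_le0 b; pose eta := Num.min (1 - t) (eps / (1 - f b)).
have D0 : 0 < 1 - f b by lra.
have eta0 : 0 < eta by rewrite lt_min subr_gt0 t1 divr_gt0.
have eta_t : eta <= 1 - t by rewrite ge_min lexx.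
have eta_eps : eta * (1 - f b) <= eps by rewrite -ler_pdivlMr // ge_min lexx orbT.
have E0 : 0 < 1 + eta by lra.
pose u := (1 + eta)^-1; pose y := u *: a + (1 - u) *: b.
have u0 : 0 <= u by rewrite invr_ge0 ltW.
have u1 : u < 1 by rewrite invf_lt1 //; lra.
have y_in : l1norm y < 1 by exact: l1norm_conv_lt.
have teta : t * eta <= 1 - t.
  apply: le_trans (_ : 1 * eta <= _); last by lra.
  by apply: ler_wpM2r; lra.
have w01 : 0 <= t * (1 + eta) <= 1.
  apply/andP; split; [by apply: mulr_ge0; lra | lra].
have -> : t *: a + (1 - t) *: b = (t * (1 + eta)) *: y + (1 - t * (1 + eta)) *: b.
  apply/rowP => k; rewrite /y /u !mxE; field; lra.
apply: le_trans (midpoint_convex_inside w01 y_in b1) _.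
have := f_le0 y; move: (f y) => fy fy0.
have : 0 <= (t * (1 + eta)) * - fy by have /andP[w0 _] := w01; apply: mulr_ge0; lra.
have : t * (eta * (1 - f b)) <= 1 * eps.
  by apply: ler_pM => //; [apply: mulr_ge0; lra | exact: ltW].
have : 0 <= t * eta by apply: mulr_ge0; lra.
by lra.
Qed.

Lemma midpoint_convex_ball t a b : 0 <= t <= 1 -> l1norm a <= 1 -> l1norm b <= 1 ->
  f (t *: a + (1 - t) *: b) <= t * f a + (1 - t) * f b.
Proof.
move=> t01 a1 b1; have [b_in|b_out] := boolP (l1norm b < 1).
  exact: midpoint_convex_boundary.
have [a_in|a_out] := boolP (l1norm a < 1).
  have t01' : 0 <= 1 - t <= 1 by move: t01 => /andP[? ?]; apply/andP; split; lra.
  have := midpoint_convex_boundary t01' b1 a_in.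
  by rewrite subKr addrC [X in _ <= X]addrC.
by rewrite (f_boundary a_out) (f_boundary b_out) !mulr0 addr0.
Qed.

End Ball.

(** Laminates control the entropy only for sides divisible by that of the cubes, so the limit is
    bounded along arbitrarily large such indices. *)
Lemma lim_le_frequently (R : realType) (u : R^nat) (c : R) : cvg (u @ \oo) ->
  (forall M, exists2 i, (M <= i)%N & u i <= c) -> lim (u @ \oo) <= c.
Proof.
move=> cu freq; rewrite leNgt; apply/negP => lt_c.
have [M _ uM] := cvgr_gt _ cu _ lt_c.
by have [i Mi] := freq M; rewrite leNgt uM.
Qed.

Section Entropy.
Variables (R : realType) (m d : nat) (g : int -> tree d).
Hypothesis g_geodesic : two_sided_geodesic g.
Hypothesis g0 : g 0 = tree_root d.
Hypothesis g_periodic : periodic_geodesic g.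
Hypothesis m2 : (2 <= m)%N.
Hypothesis limit_exists : forall s : 'rV[R]_m, l1norm s < 1 -> cvg (ent_seq g s @ \oo).
Implicit Types s : 'rV[R]_m.

Lemma ent_n_le0 n s : ent_n n g s <= 0.
Proof.
rewrite /ent_n oppr_le0 divr_ge0 ?exprn_ge0 //.
by case: (#|` _|) => [|k]; [rewrite ln0 | rewrite ln_ge0 // (ler_nat R 1)].
Qed.

Lemma entE s : l1norm s < 1 -> ent g s = lim (ent_seq g s @ \oo).
Proof. by rewrite /ent => ->. Qed.

Lemma ent_le0 s : ent g s <= 0.
Proof.
rewrite /ent; case: ifP => // s1; apply: lim_le_frequently; first exact: limit_exists.
by move=> M; exists M => //; exact: ent_n_le0.
Qed.

(** Bernoulli's inequality with y = 2/(J+2) <= 2/J gives a loss of 2m/J, to which the kinks add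
    1/J. *)
Lemma filling_ge J : (0 < J)%N -> 1 - (2 * m + 1)%N%:R / J%:R <= filling R m J.
Proof.
move=> J0; have j0 : 0 < (J%:R : R) by rewrite ltr0n.
have bernoulli (y : R) k : 0 <= y <= 1 -> 1 - k%:R * y <= (1 - y) ^+ k.
  move=> /andP[y0 y1]; elim: k => [|k IH]; first by rewrite mul0r subr0 expr0.
  rewrite exprS; apply: le_trans (_ : (1 - y) * (1 - k%:R * y) <= _).
    rewrite -[k.+1]addn1 natrD; have : 0 <= k%:R * (y * y) by rewrite !mulr_ge0.
    by lra.
  by apply: ler_wpM2l => //; rewrite subr_ge0.
pose y : R := 2 / (J + 2)%N%:R.
have J2 : 0 < ((J + 2)%N%:R : R) by rewrite ltr0n addn_gt0 J0.
have yE : J%:R / (J + 2)%N%:R = 1 - y by rewrite /y natrD; field; rewrite -natrD gt_eqF.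
have y0 : 0 <= y by rewrite divr_ge0.
have y_le : y <= 2 / J%:R by rewrite ler_pM2l // lef_pV2 ?posrE // ler_nat leq_addr.
have y1 : y <= 1 by rewrite ler_pdivrMr // mul1r ler_nat leq_addl.
have JE : J.-1%:R / J%:R = 1 - J%:R^-1 :> R.
  by rewrite -subn1 natrB // mulrBl divff ?gt_eqF // mul1r.
have J1 : 0 <= (J%:R^-1 : R) <= 1 by rewrite invr_ge0 invf_le1 // (ler_nat R 1) J0 ltW.
rewrite /filling yE JE; apply: le_trans (_ : (1 - J%:R^-1) * (1 - m%:R * y) <= _).
  have : 0 <= J%:R^-1 * (m%:R * y) by rewrite !mulr_ge0 //; case/andP: J1.
  have : m%:R * y <= m%:R * (2 / J%:R) by apply: ler_wpM2l.
  by rewrite natrD natrM; lra.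
apply: ler_wpM2l; first by case/andP: J1 => _; rewrite subr_ge0.
by apply: bernoulli; rewrite y0.
Qed.

(** For fixed [J], a single large [n] brings both entropies close to their limits, and the limit for
    [s] is taken along cells growing with [mu]. Finally a large [J] makes the filling close to 1. *)
Lemma ent_midpoint s1 s2 s : l1norm s1 < 1 -> l1norm s2 < 1 ->
  (forall k, 2 * s 0 k = s1 0 k + s2 0 k) -> ent g s <= (ent g s1 + ent g s2) / 2.
Proof.
move=> s1_in s2_in s12.
have s_in : l1norm s < 1.
  have -> : s = 2^-1 *: s1 + (1 - 2^-1) *: s2.
    apply/rowP => k; rewrite !mxE (_ : s 0 k = (s1 0 k + s2 0 k) / 2); [by field | by rewrite -s12; field].
  have h0 : 0 <= (2^-1 : R) by rewrite invr_ge0.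
  have h1 : (2^-1 : R) < 1 by rewrite invf_lt1 // ltr1n.
  exact: l1norm_conv_lt h0 h1 (ltW s1_in) s2_in.
have [p p0 pP] : exists2 p : nat, (0 < p)%N &
    forall s' k, l1norm s' <= Num.max (l1norm s1) (l1norm s2) -> `|s' 0 k| + 2 / p%:R <= 1.
  set r := Num.max _ _; have r1 : r < 1 by rewrite gt_max s1_in.
  have p_gt : 2 / (1 - r) < (Num.truncn (2 / (1 - r))).+1%:R by exact: truncnS_gt.
  exists (Num.truncn (2 / (1 - r))).+1 => // s' k s'r.
  have p0 : 0 < ((Num.truncn (2 / (1 - r))).+1%:R : R) by [].
  have D0 : 0 < 1 - r by rewrite subr_gt0.
  have p_le : 2 / (Num.truncn (2 / (1 - r))).+1%:R <= 1 - r.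
    by rewrite ler_pdivrMr // mulrC -ler_pdivrMr // ltW.
  apply: le_trans (lerD (le_trans (l1norm_entry s' k) s'r) p_le) _.
  by rewrite addrC subrK.
have s1p k := pP s1 k ltac:(by rewrite le_max lexx).
have s2p k := pP s2 k ltac:(by rewrite le_max lexx orbT).
set A := ent g s1 + ent g s2.
have A_le0 : A <= 0 by rewrite -[0]addr0; apply: lerD; exact: ent_le0.
have fill_ge0 J : 0 <= filling R m J.
  by rewrite mulr_ge0 ?divr_ge0 // exprn_ge0 // divr_ge0.
have le_J J : (0 < J)%N -> ent g s <= filling R m J / 2 * A.
  move=> J0; apply/ler_addgt0Pr => eps eps0.
  (* Three errors of size [delta] arise: one from each of the two limits and one from the
     skeleton. *)
  pose delta := eps / (3 * (filling R m J / 2 + 1)).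
  have D0 : 0 < 3 * (filling R m J / 2 + 1) by have := fill_ge0 J; lra.
  have delta0 : 0 < delta by rewrite divr_gt0.
  have c1 := limit_exists s1_in; have c2 := limit_exists s2_in.
  have [|M1 _ H1] := cvgr_lt _ c1 (ent g s1 + delta); first by rewrite entE // ltrDl.
  have [|M2 _ H2] := cvgr_lt _ c2 (ent g s2 + delta); first by rewrite entE // ltrDl.
  pose M3 := (Num.truncn (entropy_error R m d / delta)).+1.
  pose j := (M1 + M2 + M3 + 4 * even_period g * (J + 2) * p)%N.
  have j0 : (0 < j)%N by rewrite /j /M3; lia.
  have jR : 0 < (j%:R : R) by rewrite ltr0n.
  have err : 2 * entropy_error R m d / j.*2%:R <= delta.
    have -> : 2 * entropy_error R m d / j.*2%:R = entropy_error R m d / j%:R.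
      by rewrite -muln2 natrM; field; rewrite gt_eqF.
    rewrite ler_pdivrMr // mulrC -ler_pdivrMr //.
    apply: le_trans (_ : M3%:R <= _); first by apply/ltW; exact: truncnS_gt.
    by rewrite ler_nat /j -addnA addnC -!addnA leq_addr.
  have j_even : ~~ odd j.*2 by rewrite odd_double.
  have j2_gt0 : (0 < j.*2)%N by rewrite double_gt0.
  have j_large : (4 * even_period g * (J + 2) * p <= j.*2)%N.
    by rewrite -addnn; apply: leq_trans (leq_addr _ _); exact: leq_addl.
  apply: le_trans (_ : filling R m J / 2 * (A + 3 * delta) <= _); last first.
    have : filling R m J / 2 * (3 * delta) <= eps.
      have F0 : 0 <= filling R m J / 2 by rewrite divr_ge0.
      have -> : eps = (filling R m J / 2 + 1) * (3 * delta).
        by rewrite /delta; field; rewrite gt_eqF //; have := fill_ge0 J; lra.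
      by apply: ler_wpM2r; [apply: mulr_ge0; [|exact: ltW] | lra].
    by rewrite mulrDr; lra.
  rewrite entE //; apply: lim_le_frequently; first exact: limit_exists.
  move=> M; pose mu := (M + 2 * p * (8 * (12 * m * p * even_period g) * J + 12 * m))%N.
  have mu_large : (2 * p * (8 * (12 * m * p * even_period g) * J + 12 * m) <= mu)%N.
    exact: leq_addl.
  (* This is half the side of the cell, because [ent_seq] runs over even sides. *)
  exists (j * (J * mu + 2 * mu))%N; 
    have M_mu : (M <= mu)%N by exact: leq_addr.
    apply: (leq_trans M_mu); apply: leq_trans (leq_pmull (J * mu + 2 * mu) j0).
    by apply: leq_trans (leq_addl (J * mu) (2 * mu)); exact: leq_pmull.
  have := ent_laminate g_geodesic g0 g_periodic m2 j2_gt0 j_even J0 p0 s1p s2p s12 j_large mu_large.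
  rewrite -doubleMl => le1; apply: le_trans le1 _; apply: ler_wpM2l.
    by have := fill_ge0 J; lra.
  have j1 : (M1 <= j)%N by rewrite /j -!addnA leq_addr.
  have j2 : (M2 <= j)%N by rewrite /j -!addnA addnCA leq_addr.
  have -> : A + 3 * delta = ent g s1 + delta + (ent g s2 + delta) + delta.
    by rewrite /A; move: (ent g s1) (ent g s2) => u v; ring.
  by apply: lerD err; apply: lerD; apply: ltW; [exact: H1 | exact: H2].
apply/ler_addgt0Pr => eps eps0.
pose J := (Num.truncn ((2 * m + 1)%N%:R * - A / eps)).+1.
have JP : (2 * m + 1)%N%:R * - A / eps < J%:R by exact: truncnS_gt.
have J0 : 0 < (J%:R : R) by [].
have J1 : (2 * m + 1)%N%:R / J%:R * - A <= eps.
  by rewrite mulrAC ler_pdivrMr // [eps * _]mulrC -ler_pdivrMr // ltW.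
have := le_J J isT; have := filling_ge (isT : 0 < J)%N.
move: (filling R m J) (_ / J%:R) J1 => F c cA Fc le_F.
have : F * A <= (1 - c) * A by apply: ler_wnM2r.
by lra.
Qed.

Lemma ent_convex t (a b : 'rV[R]_m) : 0 <= t <= 1 -> l1norm a <= 1 -> l1norm b <= 1 ->
  ent g (t *: a + (1 - t) *: b) <= t * ent g a + (1 - t) * ent g b.
Proof.
apply: midpoint_convex_ball; [exact: ent_le0 | exact: ent_midpoint |].
by move=> x /negbTE x1; rewrite /ent x1.
Qed.

End Entropy.

Unset Implicit Arguments.

Theorem theorem3p15 (R : realType) (m d : nat) (m2 : (2 <= m)%N)
    (g : int -> tree d) (g_geodesic : two_sided_geodesic g)
    (g_periodic : periodic_geodesic g) (g0 : g 0 = tree_root d)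
    (limit_exists : forall s : 'rV[R]_m,
       l1norm s < 1 -> cvg (ent_seq g s @ \oo)) :
  coordinatewise_convex (@ent R m d g) /\ convex_on_ball (@ent R m d g).
Proof.
have convex (t : {i01 R}) (a b : 'rV[R]_m) : l1norm a <= 1 -> l1norm b <= 1 ->
    ent g (t%:num *: a + (1 - t%:num) *: b) <=
    t%:num * ent g a + (1 - t%:num) * ent g b.
  by apply: ent_convex => //; rewrite ge0 le1.
split=> [s k|] t a b; rewrite !inE => a1 b1; last exact: convex.
(* Changing one coordinate is an affine map, so joint convexity restricts to coordinate lines. *)
have -> : set_coord s k (conv t a b) =
    t%:num *: set_coord s k a + (1 - t%:num) *: set_coord s k b.
  apply/rowP => j; rewrite !mxE; case: eqP => // _.
  by rewrite -mulrDl addrC subrK mul1r.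
exact: convex.
Qed.
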